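(* Let $T\in \mathrm{PU}(n,1)$ be a holomorphic isometry of complex hyperbolic space $\mathrm{H}_{\mathbb C}^n$. Then $T$ is a product (in $\mathrm{PU}(n,1)$) of at most four involutions and a complex $k$-reflection, where $k\le 2$; here $k=0$ if $T$ is elliptic; $k=1$ if $T$ is an ellipto-translation or hyperbolic; $k=2$ if $T$ is ellipto-parabolic and $n>2$.
   Context: $\mathbb C^{n,1}$ is $\mathbb C^{n+1}$ with the Hermitian form $\langle z,w\rangle=\overline w^{t}Jz$, $J=\mathrm{diag}(-1,1,\dots,1)$. $\mathrm U(n,1)=\{A\in \mathrm{GL}(n+1,\mathbb C): \overline A^{t}JA=J\}$ and $\mathrm{PU}(n,1)=\mathrm U(n,1)/\{\lambda I:|\lambda|=1\}$. $\mathrm{H}_{\mathbb C}^n$ is the set of lines in $\mathbb P(\mathbb C^{n,1})$ spanned by negative vectors ($\langle z,z\rangle<0$), and $\partial \mathrm{H}_{\mathbb C}^n$ is the set of lines spanned by nonzero null vectors ($\langle z,z\rangle=0$). $\mathrm{PU}(n,1)$ acts by holomorphic isometries on $\mathrm{H}_{\mathbb C}^n$ and on its boundary. An element $g$ of a group is an involution if $g^2=1$ (so the identity is allowed). $T$ is elliptic if it has a fixed point in $\mathrm{H}_{\mathbb C}^n$; parabolic if it fixes a single point of $\overline{\mathrm{H}_{\mathbb C}^n}$ and that point lies on $\partial\mathrm{H}_{\mathbb C}^n$; hyperbolic if it fixes exactly two points of $\overline{\mathrm{H}_{\mathbb C}^n}$ and both lie on $\partial\mathrm{H}_{\mathbb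 C}^n$. An eigenvalue is null if the Hermitian form restricted to its eigenspace is degenerate. If $T$ is parabolic and none of its lifts to $\mathrm U(n,1)$ is unipotent, a lift has a null eigenvalue $\lambda$, $|\lambda|=1$, and there is an invariant orthogonal decomposition $\mathbb C^{n,1}=\mathbb U\oplus\mathbb W$ with the lift semisimple on $\mathbb W$, $\mathbb U$ indefinite (form non-degenerate and indefinite) of dimension $m\in\{2,3\}$, and both the characteristic and minimal polynomial on $\mathbb U$ equal to $(x-\lambda)^m$. $T$ is called an ellipto-translation if $m=2$ and ellipto-parabolic if $m=3$. A complex $k$-reflection is an element of $\mathrm U(n,1)$ (or the isometry it induces in $\mathrm{PU}(n,1)$) for which there is an orthogonal decomposition $\mathbb C^{n,1}=\mathbb U\oplus\mathbb U^{\perp}$ with $\dim \mathbb U=k+1$, $\mathbb U$ non-degenerate and containing negative vectors, such that the element acts on $\mathbb U$ as multiplication by a scalar $\lambda$ with $|\lambda|=1$ and on $\mathbb U^{\perp}$ (of dimension $n-k$) as the identity; $\lambda=1$ is allowed. *)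

(* Defs.v *)
From HB Require Import structures.
From mathcomp Require Import all_boot all_order all_algebra.
From mathcomp Require Import boolp reals.
From mathcomp Require Import complex.

Set Implicit Arguments.
Unset Strict Implicit.
Unset Printing Implicit Defensive.

Import Order.TTheory GRing.Theory Num.Theory Num.Def.

Local Open Scope ring_scope.
Local Open Scope quotient_scope.
Local Open Scope sesquilinear_scope.

(* Vectors of C^{n,1} are columns, and matrices act on the left.  The
   definitions are over any numClosedFieldType; the case of interest is
   C = R[i] with R : realType. *)

Section HermitianSpace.
Variables (C : numClosedFieldType) (n : nat).
Local Notation V := 'cV[C]_n.+1.

Definition Jmx : 'M[C]_n.+1 :=
  diag_mx (\row_(i < n.+1) if i == ord0 then -1 else 1).

Definition herm (z w : V) : C := (w ^t* *m Jmx *m z) 0 0.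

(* [herm v v] is real, and in the order of C the relation [x < y] says that
   y - x is real and positive. *)
Definition negative_vec (v : V) : Prop := herm v v < 0.
Definition positive_vec (v : V) : Prop := 0 < herm v v.
Definition null_vec (v : V) : Prop := herm v v = 0.

Definition degenerate_on (U : {vspace V}) : Prop :=
  exists2 v, v \in U & v != 0 /\ forall u, u \in U -> herm v u = 0.
Definition nondegenerate_on (U : {vspace V}) : Prop := ~ degenerate_on U.
Definition has_negative (U : {vspace V}) : Prop :=
  exists2 v, v \in U & negative_vec v.
Definition has_positive (U : {vspace V}) : Prop :=
  exists2 v, v \in U & positive_vec v.
Definition indefinite_on (U : {vspace V}) : Prop :=
  [/\ nondegenerate_on U, has_negative U & has_positive U].

(* As the form is non-degenerate on V, these conditions force W to be the
   full orthogonal complement of U. *)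
Definition orth_decomp (U W : {vspace V}) : Prop :=
  [/\ (U + W)%VS = fullv, directv (U + W)
    & forall u w, u \in U -> w \in W -> herm u w = 0].

(* Points of H^n and of its boundary are lines of V. *)
Definition hyp_point (L : {vspace V}) : Prop :=
  exists2 v, negative_vec v & L = <[v]>%VS.
Definition bd_point (L : {vspace V}) : Prop :=
  exists2 v, v != 0 /\ null_vec v & L = <[v]>%VS.
Definition closed_hyp_point (L : {vspace V}) : Prop :=
  hyp_point L \/ bd_point L.

Definition lact (A : 'M[C]_n.+1) : 'End(V) := linfun (mulmx A).

End HermitianSpace.

Section UnitaryGroup.
Variables (C : numClosedFieldType) (n : nat).

Definition unitary_pred : pred 'M[C]_n.+1 :=
  [pred A | (A \in unitmx) && (A ^t* *m Jmx C n *m A == Jmx C n)].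

Record Ugrp : Type := MkU { Uval :> 'M[C]_n.+1; UvalP : unitary_pred Uval }.

HB.instance Definition _ := [isSub for Uval].
HB.instance Definition _ := [Choice of Ugrp by <:].

Lemma UE (A : Ugrp) : (A : 'M_n.+1) ^t* *m Jmx C n *m A = Jmx C n.
Proof. by case: A => A /= /andP[_ /eqP]. Qed.

Lemma Uunit (A : Ugrp) : (A : 'M_n.+1) \in unitmx.
Proof. by case: A => A /= /andP[]. Qed.

Lemma trC_mul (A B : 'M[C]_n.+1) : (A *m B) ^t* = B ^t* *m A ^t*.
Proof. by rewrite trmx_mul map_mxM. Qed.

Lemma trC_scalar (c : C) : (c%:M : 'M[C]_n.+1) ^t* = (c^*)%:M.
Proof. by rewrite tr_scalar_mx map_scalar_mx. Qed.

Lemma U1_subproof : unitary_pred 1%:M.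
Proof.
apply/andP; split; first exact: unitmx1.
by rewrite trC_scalar conjC1 mul1mx mulmx1 eqxx.
Qed.

Lemma UM_subproof (A B : Ugrp) : unitary_pred (Uval A *m Uval B).
Proof.
apply/andP; split; first by rewrite unitmx_mul !Uunit.
apply/eqP; rewrite -[RHS](UE B) -[in RHS](UE A) trC_mul.
by rewrite !mulmxA.
Qed.

Lemma UV_subproof (A : Ugrp) : unitary_pred (invmx (Uval A)).
Proof.
apply/andP; split; first by rewrite unitmx_inv Uunit.
apply/eqP.
rewrite -{1}(UE A) !mulmxA -trC_mul mulmxV ?Uunit // trC_scalar conjC1 mul1mx.
by rewrite -mulmxA mulmxV ?Uunit // mulmx1.
Qed.

Definition Uone : Ugrp := MkU U1_subproof.
Definition Umul (A B : Ugrp) : Ugrp := MkU (UM_subproof A B).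
Definition Uinv (A : Ugrp) : Ugrp := MkU (UV_subproof A).

Lemma UmulA : associative Umul.
Proof. by move=> A B D; apply: val_inj; rewrite /= mulmxA. Qed.
Lemma Umul1 : left_id Uone Umul.
Proof. by move=> A; apply: val_inj; rewrite /= mul1mx. Qed.
Lemma Umulr1 : right_id Uone Umul.
Proof. by move=> A; apply: val_inj; rewrite /= mulmx1. Qed.
Lemma UmulV : left_inverse Uone Uinv Umul.
Proof. by move=> A; apply: val_inj; rewrite /= mulVmx ?Uunit. Qed.
Lemma UmulrV : right_inverse Uone Uinv Umul.
Proof. by move=> A; apply: val_inj; rewrite /= mulmxV ?Uunit. Qed.

HB.instance Definition _ :=
  isGroup.Build Ugrp UmulA Umul1 Umulr1 UmulV UmulrV.

Definition proj_eq : rel Ugrp := fun A B =>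
  `[< exists2 c : C, `|c| = 1 & Uval B = c *: Uval A >].

Lemma proj_eq_refl : reflexive proj_eq.
Proof. by move=> A; apply/asboolP; exists 1; rewrite ?normr1 ?scale1r. Qed.

Lemma proj_eq_sym : symmetric proj_eq.
Proof.
have H A B : proj_eq A B -> proj_eq B A.
  move=> /asboolP[c c1 E]; apply/asboolP; exists c^-1.
    by rewrite normfV c1 invr1.
  by rewrite E scalerA mulVf ?scale1r // -normr_gt0 c1.
by move=> A B; apply/idP/idP; apply: H.
Qed.

Lemma proj_eq_trans : transitive proj_eq.
Proof.
move=> B A D /asboolP[c c1 E] /asboolP[d d1 F]; apply/asboolP.
by exists (d * c); rewrite ?normrM ?c1 ?d1 ?mulr1 // F E scalerA.
Qed.

Canonical proj_equiv : equiv_rel Ugrp :=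
  EquivRel proj_eq proj_eq_refl proj_eq_sym proj_eq_trans.

Definition PU : Type := {eq_quot proj_eq}.

HB.instance Definition _ := Choice.on PU.
HB.instance Definition _ := EqQuotient.on PU.

Definition piPU (A : Ugrp) : PU := \pi_PU A.

Lemma piPUP (A B : Ugrp) :
  piPU A = piPU B <-> exists2 c : C, `|c| = 1 & Uval B = c *: Uval A.
Proof.
split=> [/eqP|H]; first by rewrite eqmodE => /asboolP.
by apply/eqP; rewrite eqmodE; apply/asboolP.
Qed.

Definition PUone : PU := piPU Uone.
Definition PUmul (g h : PU) : PU := piPU (Umul (repr g) (repr h)).
Definition PUinv (g : PU) : PU := piPU (Uinv (repr g)).

Lemma repr_piPU (A : Ugrp) :
  exists2 c : C, `|c| = 1 & Uval (repr (piPU A)) = c *: Uval A.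
Proof. by apply/piPUP; rewrite /piPU reprK. Qed.

Lemma piPU_mul (A B : Ugrp) : PUmul (piPU A) (piPU B) = piPU (Umul A B).
Proof.
have [c c1 E] := repr_piPU A; have [d d1 F] := repr_piPU B.
apply/esym/piPUP; exists (c * d); first by rewrite normrM c1 d1 mulr1.
by rewrite /= E F -scalemxAl -scalemxAr scalerA.
Qed.

Lemma piPU_inv (A : Ugrp) : PUinv (piPU A) = piPU (Uinv A).
Proof.
have [c c1 E] := repr_piPU A.
have c0 : c != 0 by rewrite -normr_gt0 c1.
apply/esym/piPUP; exists c^-1; first by rewrite normfV c1 invr1.
by rewrite /= E invmxZ // unitmxZ ?unitfE ?c0 ?Uunit.
Qed.

Lemma PUmulA : associative PUmul.
Proof.
move=> g h k; rewrite -[g]reprK -[h]reprK -[k]reprK -!/(piPU _).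
by rewrite !piPU_mul UmulA.
Qed.
Lemma PUmul1 : left_id PUone PUmul.
Proof. by move=> g; rewrite -[g]reprK -!/(piPU _) piPU_mul Umul1. Qed.
Lemma PUmulr1 : right_id PUone PUmul.
Proof. by move=> g; rewrite -[g]reprK -!/(piPU _) piPU_mul Umulr1. Qed.
Lemma PUmulV : left_inverse PUone PUinv PUmul.
Proof.
by move=> g; rewrite -[g]reprK -!/(piPU _) piPU_inv piPU_mul UmulV.
Qed.
Lemma PUmulrV : right_inverse PUone PUinv PUmul.
Proof.
by move=> g; rewrite -[g]reprK -!/(piPU _) piPU_inv piPU_mul UmulrV.
Qed.

HB.instance Definition _ :=
  isGroup.Build PU PUmulA PUmul1 PUmulr1 PUmulV PUmulrV.

End UnitaryGroup.

Arguments piPU {C n} A.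

Section Isometries.
Variables (C : numClosedFieldType) (n : nat).
Local Notation V := 'cV[C]_n.+1.
Implicit Types (T : PU C n) (A : Ugrp C n) (L U W : {vspace V}).

(* Independent of the chosen representative: see [pu_actE]. *)
Definition pu_act T L : {vspace V} := (lact (repr T) @: L)%VS.

Lemma pu_actE A L : pu_act (piPU A) L = (lact A @: L)%VS.
Proof.
have [c c1 E] := repr_piPU A; have c0 : c != 0 by rewrite -normr_gt0 c1.
rewrite /pu_act; apply/vspaceP => x; apply/memv_imgP/memv_imgP => -[u uL ->].
  exists (c *: u); first exact: memvZ.
  by rewrite !lfunE /= E -scalemxAl -scalemxAr.
exists (c^-1 *: u); first exact: memvZ.
by rewrite !lfunE /= E -scalemxAl -scalemxAr scalerA mulfV // scale1r.
Qed.

Definition fixes T L : Prop := pu_act T L = L.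

Definition elliptic T : Prop := exists2 L, hyp_point L & fixes T L.

Definition parabolic T : Prop :=
  exists L, [/\ bd_point L, fixes T L
    & forall L', closed_hyp_point L' -> fixes T L' -> L' = L].

Definition hyperbolic T : Prop :=
  exists L1 L2, [/\ L1 <> L2, bd_point L1, bd_point L2
    & forall L', closed_hyp_point L' -> (fixes T L' <-> L' = L1 \/ L' = L2)].

Definition unipotent A : Prop := exists N, (Uval A - 1) ^+ N = 0.

Definition null_eigenvalue A (l : C) : Prop :=
  passmx.leigenvalue (lact A) l /\ degenerate_on (passmx.leigenspace (lact A) l).

Definition preserves A U : Prop := (lact A @: U <= U)%VS.

Definition semisimple_on A W : Prop :=
  forall U, (U <= W)%VS -> preserves A U ->
    exists U', [/\ (U' <= W)%VS, preserves A U', (U + U')%VS = W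
                 & directv (U + U')].

(* For a basis b of an invariant subspace, the matrix in b of the restriction
   of A to that subspace. *)
Definition matrix_in (d : nat) (b : d.-tuple V) A : 'M[C]_d :=
  \matrix_(i, j) coord b i (lact A b`_j).

(* The dimension of U is m.+1, as [mxminpoly] is defined only for matrices of
   positive size. *)
Definition jordan_part (m : nat) T : Prop :=
  exists (A : Ugrp C n) (l : C) (U W : {vspace V}),
    [/\ piPU A = T, null_eigenvalue A l & `|l| = 1] /\
    [/\ orth_decomp U W, preserves A U, preserves A W & semisimple_on A W] /\
    [/\ indefinite_on U & exists b : m.+1.-tuple V,
      [/\ basis_of U b,
          char_poly (matrix_in b A) = ('X - l%:P) ^+ m.+1
        & mxminpoly (matrix_in b A) = ('X - l%:P) ^+ m.+1]].

Definition nonunipotent_parabolic T : Prop :=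
  parabolic T /\ forall A, piPU A = T -> ~ unipotent A.

Definition ellipto_translation T : Prop :=
  nonunipotent_parabolic T /\ jordan_part 1 T.

Definition ellipto_parabolic T : Prop :=
  nonunipotent_parabolic T /\ jordan_part 2 T.

Definition involution T : Prop := (T ^+ 2)%g = 1%g.

Definition kreflection (k : nat) A : Prop :=
  exists (U W : {vspace V}) (l : C),
    [/\ orth_decomp U W, \dim U = k.+1, nondegenerate_on U & has_negative U] /\
    [/\ `|l| = 1, forall u, u \in U -> lact A u = l *: u
      & forall w, w \in W -> lact A w = w].

Definition kreflection_isometry (k : nat) T : Prop :=
  exists2 A, piPU A = T & kreflection k A.

(* Conjugating an involution gives an involution, so the place of the
   reflection in the product is immaterial. *)
Definition inv4_reflection (k : nat) T : Prop :=
  exists (s : seq (PU C n)) (r : PU C n),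
    [/\ (size s <= 4)%N, forall g, g \in s -> involution g,
        kreflection_isometry k r & T = ((\prod_(g <- s) g) * r)%g].

End Isometries.

(* Main.v *)
Require Import Defs.
From mathcomp Require Import all_boot all_order perm all_algebra.
From mathcomp Require Import boolp reals complex ring.

(** The proof separates isometries that fix a point of the ball from those that
    fix a boundary point; every isometry is of one of these kinds
    ([nonpositive_eigenvector]).  Call an isometry bireflectional when it is a
    product of two involutions.

    The definite case rests on a telescoping identity.  A unitary matrix of
    determinant 1 has eigenvalues b_0, ..., b_(m-1) in an orthonormal eigenbasis,
    and the partial products p_k = b_0 ... b_(k-1) satisfy p_0 = p_m = 1.  The diagonal matrices with entries
    p_1, 1/p_1, p_3, 1/p_3, ... and 1, p_2, 1/p_2, p_4, ... multiply to it, and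
    diag(z, 1/z) is the swap of the two coordinates times another involution;
    so the matrix is a product of two bireflectional ones
    ([bireflectional_unitary_factorization]).  In PU(n,1) the lift may be
    rescaled, which brings the determinant of a definite block to any
    prescribed value of modulus 1, and in particular makes room for a reflection
    acting on part of the block ([scaled_unitary_factorization]).

    If the lift A has a negative eigenvector v, then A is the sum of a scalar on
    the line of v and a unitary matrix on its orthogonal complement.  The scalar
    is a complex 0-reflection and the unitary part is handled as above.

    If A has a null eigenvector f with eigenvalue l, write om = l / |l| and
    choose a null vector g and an orthonormal family w completing f to a frame.
    Then A is block triangular for the flag f, f^perp, and its diagonal blocks are
    l, a unitary B and 1 / conj(l).  Up to rescaling, B = X Y S with X, Y
    bireflectional and S a reflection.  Let U be the isometry that is diagonal in
    the frame with blocks 2|l|, X, 1/(2|l|).  It is bireflectional, and U^-1 A is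
    still triangular, with blocks om/2, Y S, 2 om.  As om/2 does not have modulus
    1, an isometry of this shape is diagonalizable: there is another null frame
    f, g', w' in which it is exactly diag(om/2, Y S, 2 om)
    ([null_frame_diagonalize]), that is diag(1/2, Y, 2) times diag(om, S, om).
    The first factor is bireflectional and the second is a complex reflection.
    So every isometry that fixes a boundary point is a product of four
    involutions and a k-reflection with k = 1, or with any k such that
    1 < k < n ([boundary_inv4_reflection]); hyperbolic and parabolic isometries
    are treated alike, and S supplies the k - 1 further dimensions.

    It remains that the value of k prescribed by the type of T is unambiguous.
    The only point that is not immediate from fixed points is that T is not both
    an ellipto-translation and ellipto-parabolic: the second condition produces
    a generalized eigenvector of height 3 and the first forbids one. *)

Set Implicit Arguments.
Unset Strict Implicit.
Unset Printing Implicit Defensive.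

Import Order.TTheory GRing.Theory Num.Theory.
Local Open Scope ring_scope.
Local Open Scope sesquilinear_scope.

(** * Products of two involutions preserving a Hermitian form *)

Section Bireflections.
Variable C : numClosedFieldType.

Lemma trCM m n p (A : 'M[C]_(m, n)) (B : 'M_(n, p)) :
  (A *m B) ^t* = B ^t* *m A ^t*.
Proof. by rewrite trmx_mul map_mxM. Qed.

Lemma trC1 n : (1%:M : 'M[C]_n) ^t* = 1%:M.
Proof. by rewrite trmx1 map_mx1. Qed.

Lemma trC0 m n : (0 : 'M[C]_(m, n)) ^t* = 0.
Proof. by rewrite trmx0 map_mx0. Qed.

Lemma trCZ m n c (A : 'M[C]_(m, n)) : (c *: A) ^t* = c^* *: A ^t*.
Proof. by rewrite linearZ /= map_mxZ. Qed.

Lemma trCD m n (A B : 'M[C]_(m, n)) : (A + B) ^t* = A ^t* + B ^t*.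
Proof. by rewrite linearD /= map_mxD. Qed.

Lemma trCB m n (A B : 'M[C]_(m, n)) : (A - B) ^t* = A ^t* - B ^t*.
Proof. by rewrite linearB /= map_mxB. Qed.

Lemma trC_row m n p (A : 'M[C]_(m, n)) (B : 'M_(m, p)) :
  (row_mx A B) ^t* = col_mx (A ^t*) (B ^t*).
Proof. by rewrite tr_row_mx map_col_mx. Qed.

Lemma trC_block m n p q (A : 'M[C]_(m, n)) B D (E : 'M_(p, q)) :
  (block_mx A B D E) ^t* = block_mx (A ^t*) (D ^t*) (B ^t*) (E ^t*).
Proof. by rewrite tr_block_mx map_block_mx. Qed.

Lemma trC_diag n (d : 'rV[C]_n) :
  (diag_mx d) ^t* = diag_mx (\row_i (d 0 i)^*).
Proof.
by rewrite tr_diag_mx map_diag_mx; congr diag_mx; apply/rowP=> i; rewrite !mxE.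
Qed.

(** H is arbitrary so that the same lemmas serve the ambient form, the standard
    definite form and the form read in a frame. *)
Definition isometric N (H A : 'M[C]_N) := A ^t* *m H *m A = H.

Definition bireflectional N (H X : 'M[C]_N) :=
  exists I1 I2, [/\ isometric H I1, I1 *m I1 = 1%:M, isometric H I2,
    I2 *m I2 = 1%:M & X = I1 *m I2].

Lemma isometric_form N (H A : 'M[C]_N) p q (u : 'M_(N, p)) (v : 'M_(N, q)) :
  isometric H A -> (A *m u) ^t* *m H *m (A *m v) = u ^t* *m H *m v.
Proof. by move=> hA; rewrite trCM -[in RHS]hA !mulmxA. Qed.

Lemma isometricM N (H A B : 'M[C]_N) :
  isometric H A -> isometric H B -> isometric H (A *m B).
Proof.
by move=> hA hB; rewrite /isometric trCM -[in RHS]hB -[in RHS]hA !mulmxA.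
Qed.

Lemma isometric_bireflectional N (H X : 'M[C]_N) :
  bireflectional H X -> isometric H X.
Proof. by case=> I1 [I2 [h1 _ h2 _ ->]]; apply: isometricM. Qed.

Lemma isometric1 N (H : 'M[C]_N) : isometric H 1%:M.
Proof. by rewrite /isometric trC1 mul1mx mulmx1. Qed.

Lemma bireflectional1 N (H : 'M[C]_N) : bireflectional H 1%:M.
Proof. by exists 1%:M, 1%:M; split; rewrite ?mulmx1 //; apply: isometric1. Qed.

Lemma isometric_base_change N M (J : 'M[C]_N) (H : 'M_M) (P : 'M_(N, M))
    (Q : 'M_(M, N)) X :
  P ^t* *m J *m P = H -> P *m Q = 1%:M ->
  isometric H X -> isometric J (P *m X *m Q).
Proof.
move=> PJ PQ hX; have QH : Q ^t* *m H *m Q = J.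
  by rewrite -PJ !mulmxA -trCM -!mulmxA PQ mulmx1 trC1 mul1mx.
by rewrite /isometric !trCM -[RHS]QH -[in RHS]hX -PJ !mulmxA.
Qed.

(** P is typed as rectangular because its columns will be split into blocks
    whose widths add up to N. *)
Lemma bireflectional_base_change N M (J : 'M[C]_N) (H : 'M_M) (P : 'M_(N, M))
    (Q : 'M_(M, N)) X :
  P ^t* *m J *m P = H -> P *m Q = 1%:M -> Q *m P = 1%:M ->
  bireflectional H X -> bireflectional J (P *m X *m Q).
Proof.
move=> PJ PQ QP [I1 [I2 [h1 i1 h2 i2 ->]]].
have conjM Y Z : (P *m Y *m Q) *m (P *m Z *m Q) = P *m (Y *m Z) *m Q.
  by rewrite !mulmxA -(mulmxA _ Q P) QP mulmx1.
exists (P *m I1 *m Q), (P *m I2 *m Q); split; rewrite ?conjM ?i1 ?i2 ?mulmx1 //.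
  exact: isometric_base_change PJ PQ h1.
exact: isometric_base_change PJ PQ h2.
Qed.

Lemma isometric_block p q (H : 'M[C]_p) (K : 'M_q) A B :
  isometric H A -> isometric K B ->
  isometric (block_mx H 0 0 K) (block_mx A 0 0 B).
Proof.
move=> hA hB; rewrite /isometric trC_block !trC0 !mulmx_block.
by rewrite !(mulmx0, mul0mx, addr0, add0r) hA hB.
Qed.

Lemma bireflectional_block p q (H : 'M[C]_p) (K : 'M_q) X Y :
  bireflectional H X -> bireflectional K Y ->
  bireflectional (block_mx H 0 0 K) (block_mx X 0 0 Y).
Proof.
case=> I1 [I2 [h1 i1 h2 i2 ->]] [L1 [L2 [g1 l1 g2 l2 ->]]].
exists (block_mx I1 0 0 L1), (block_mx I2 0 0 L2).
have bM (Z Z' : 'M[C]_p) (W W' : 'M_q) :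
    block_mx Z 0 0 W *m block_mx Z' 0 0 W' = block_mx (Z *m Z') 0 0 (W *m W').
  by rewrite mulmx_block !(mulmx0, mul0mx, addr0, add0r).
split; rewrite ?bM ?i1 ?i2 ?l1 ?l2 -?scalar_mx_block //;
  exact: isometric_block.
Qed.

(** Writing p for the permutation matrix of s, the hypothesis says p D p = D^-1,
    so that D p is an involution and D = (D p) p. *)
Lemma bireflectional_diag m (s : {perm 'I_m}) (d : 'I_m -> C) :
  involutive s -> (forall i, `|d i| = 1) -> (forall i, d (s i) * d i = 1) ->
  bireflectional 1%:M (diag_mx (\row_i d i)).
Proof.
move=> sK d1 ds; set D := diag_mx _.
have ss : (s * s = 1)%g by apply/permP=> i; rewrite permM perm1 sK.
have pp : perm_mx s *m perm_mx s = 1%:M :> 'M[C]_m.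
  by rewrite -perm_mxM ss perm_mx1.
have sV : (s^-1 = s)%g by apply/permP=> i; apply: (@perm_inj _ s); rewrite permKV sK.
have pU : isometric (1%:M : 'M[C]_m) (perm_mx s).
  by rewrite /isometric mulmx1 tr_perm_mx map_perm_mx sV.
have pDpD : perm_mx s *m D *m perm_mx s *m D = 1%:M.
  rewrite -row_permE -{2}[s]invgK -col_permE.
  apply/matrixP=> i j; rewrite mul_mx_diag !mxE sV (inj_eq perm_inj).
  by case: eqP => [->|_]; rewrite ?mulr1n ?ds ?mulr0n ?mul0r.
exists (D *m perm_mx s), (perm_mx s); split => //.
- apply: isometricM pU; rewrite /isometric mulmx1 trC_diag mulmx_diag -diag_const_mx.
  congr diag_mx; apply/rowP=> i; rewrite !mxE mulrC -normCK d1 expr1n //.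
- have := congr1 (fun X => D *m X *m invmx D) pDpD.
  have [_ Du] := mulmx1_unit pDpD.
  by rewrite mulmx1 mulmxV // !mulmxA -(mulmxA _ D (invmx D)) mulmxV // mulmx1.
by rewrite -mulmxA pp mulmx1.
Qed.

(** The entries come in pairs (z, 1/z) at positions 2i, 2i+1 when e is false and
    2i+1, 2i+2 when e is true.  The unpaired positions, at both ends, carry the
    entry 1 because p 0 = p m = 1. *)
Lemma bireflectional_telescope m (e : bool) (p : nat -> C) :
  p 0 = 1 -> p m = 1 -> (forall k, `|p k| = 1) ->
  bireflectional 1%:M
    (diag_mx (\row_(i < m) (if odd i == e then p i.+1 else (p i)^-1))).
Proof.
move=> p0 pm p1; have pn0 k : p k != 0 by rewrite -normr_gt0 p1.
(* h exchanges the two positions of a pair; position 0 is fixed if e is true,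
   since 0.-1 = 0, and a last unpaired position has its partner out of range. *)
pose h i := if odd i == e then i.+1 else i.-1.
have hK : involutive h.
  by move=> [|[|i]]; rewrite /h /=; case: (e) => //=; case E: (odd i); rewrite /= ?E.
pose s (i : 'I_m) : 'I_m := insubd i (h i).
have sE i : s i = (if (h i < m)%N then h i else i) :> nat by rewrite val_insubd.
have sK : involutive s.
  move=> i; apply: val_inj; rewrite /= !sE.
  by case: (ltnP (h i) m) => him; rewrite ?hK ?ltn_ord // ltnNge him.
pose c k := if odd k == e then p k.+1 else (p k)^-1.
have cs k : c (h k) * c k = 1.
  case: k => [|k]; rewrite /c /h /=; case: (e) => /=;
    first [by rewrite p0 invr1 mulr1 | by rewrite mulVf
    | by case E: (odd k); rewrite /= ?E /= ?mulVf ?mulfV].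
apply: (bireflectional_diag (s := perm (inv_inj sK)) (d := c)) => i.
- by rewrite !permE sK.
- by rewrite /c; case: ifP; rewrite ?normfV p1 ?invr1.
rewrite permE sE; case: ifP => [_|]; first exact: cs.
rewrite /c; case: (boolP (odd i == e)) => oie; rewrite /h ?oie ?(negPf oie).
  move=> /negbT; rewrite -leqNgt => le_mi.
  have -> : i.+1 = m by apply/anti_leq; rewrite ltn_ord.
  by rewrite pm mulr1.
by rewrite (leq_ltn_trans (leq_pred _) (ltn_ord i)).
Qed.

(** In an eigenbasis, with p the sequence of partial products of the eigenvalues,
    the two telescoping diagonals multiply to p i.+1 / p i, the i-th eigenvalue. *)
Lemma bireflectional_unitary_factorization m (B : 'M[C]_m) :
  B ^t* *m B = 1%:M -> \det B = 1 ->
  exists X Y, [/\ bireflectional 1%:M X, bireflectional 1%:M Y & B = X *m Y].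
Proof.
move=> BB detB; have Bn : B \is normalmx.
  by apply/normalmxP; rewrite BB; apply: mulmx1C.
have BE := orthomx_spectralP Bn.
set Q := spectralmx B in BE; set b := spectral_diag B in BE.
have Qu : Q \is unitarymx := spectral_unitarymx B.
rewrite invmx_unitary // in BE.
have QQ : Q *m Q ^t* = 1%:M by apply/unitarymxP.
have QQ' := mulmx1C QQ.
have b1 i : `|b 0 i| = 1.
  have : (diag_mx b) ^t* *m diag_mx b = 1%:M.
    have -> : diag_mx b = Q *m B *m Q ^t*.
      by rewrite BE !mulmxA QQ mul1mx -mulmxA QQ mulmx1.
    rewrite !trCM trmxCK !mulmxA -(mulmxA _ _ Q) QQ' mulmx1.
    by rewrite -(mulmxA _ _ B) BB mulmx1.
  rewrite trC_diag mulmx_diag => /matrixP /(_ i i); rewrite !mxE eqxx !mulr1n.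
  by rewrite mulrC -normCK => /eqP; rewrite sqrp_eq1 // => /eqP.
pose p k := \prod_(i < m | (i < k)%N) b 0 i.
have p0 : p 0 = 1 by rewrite /p big_pred0.
have pS (i : 'I_m) : p i.+1 = p i * b 0 i.
  rewrite /p (bigD1 i) //= mulrC; congr (_ * _); apply: eq_bigl => j.
  by rewrite ltnS [RHS]ltn_neqAle andbC.
have pm : p m = 1.
  transitivity (\det B); last by [].
  rewrite BE !det_mulmx mulrAC -det_mulmx QQ' det1 mul1r det_diag.
  by apply: eq_bigl => i; rewrite ltn_ord.
have p1 k : `|p k| = 1 by rewrite normr_prod big1.
have pn0 k : p k != 0 by rewrite -normr_gt0 p1.
have PQ : (Q ^t*) ^t* *m 1%:M *m Q ^t* = 1%:M by rewrite trmxCK mulmx1.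
have hX := bireflectional_base_change PQ QQ' QQ (bireflectional_telescope false p0 pm p1).
have hY := bireflectional_base_change PQ QQ' QQ (bireflectional_telescope true p0 pm p1).
set X := Q^t* *m _ *m Q in hX; set Y := Q^t* *m _ *m Q in hY.
exists X, Y; split => //; rewrite /X /Y !mulmxA -(mulmxA _ Q) QQ mulmx1.
rewrite -(mulmxA (Q^t*)) mulmx_diag BE; congr (_ *m diag_mx _ *m _).
apply/rowP=> i; rewrite !mxE eqb_id eqbF_neg.
case: (odd i) => /=; rewrite pS.
  by rewrite mulKf.
by rewrite mulrAC mulfV ?mul1r.
Qed.

Lemma root_of_unit_norm k (z : C) : (0 < k)%N -> `|z| = 1 ->
  exists2 c : C, `|c| = 1 & c ^+ k = z.
Proof.
move=> k0 z1; exists (k.-root z); last exact: rootCK.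
apply/eqP; rewrite -(@pexpr_eq1 _ _ k) //; last by rewrite -normrX rootCK // z1.
Qed.

Lemma det_pid_copid m j (w : C) : (j <= m)%N ->
  \det (w *: pid_mx j + copid_mx j : 'M[C]_m) = w ^+ j.
Proof.
move=> jm; have -> : w *: pid_mx j + copid_mx j =
    diag_mx (\row_(i < m) if (i < j)%N then w else 1).
  apply/matrixP=> i k; rewrite !mxE.
  case: (altP (i =P k)) => [<-|nik].
    by rewrite eqxx /=; case: ifP; rewrite ?subrr ?addr0 ?mulr1 ?mulr0 ?subr0 ?add0r.
  by rewrite (negPf (nik : val i != val k)) /= mulr0 subr0 addr0.
rewrite det_diag (eq_bigr (fun i : 'I_m => if (i < j)%N then w else 1)); last first.
  by move=> i _; rewrite mxE.
by rewrite -big_mkcond -(big_ord_widen _ (fun=> w) jm) prodr_const card_ord.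
Qed.

(** E is a self-adjoint projection, so the summands are orthogonal. *)
Lemma isometric_reflection N (J E : 'M[C]_N) w :
  E *m E = E -> E ^t* *m J = J *m E -> `|w| = 1 ->
  isometric J (w *: E + (1%:M - E)).
Proof.
move=> EE EJ w1; rewrite /isometric trCD trCZ trCB trC1 mulmxDl -scalemxAl.
have -> : (1%:M - E ^t*) *m J = J *m (1%:M - E).
  by rewrite mulmxBl mulmxBr mul1mx mulmx1 EJ.
have EF : E *m (1%:M - E) = 0 by rewrite mulmxBr mulmx1 EE subrr.
have FE : (1%:M - E) *m E = 0 by rewrite mulmxBl mul1mx EE subrr.
rewrite EJ scalemxAr -mulmxDr -mulmxA; apply: etrans (mulmx1 _).
have FF : (1%:M - E) *m (1%:M - E) = 1%:M - E.
  by rewrite [LHS]mulmxBr mulmx1 FE subr0.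
have EFD : E + (1%:M - E) = 1%:M by rewrite addrC subrK.
move: (1%:M - E) EF FE FF EFD => F EF FE FF EFD.
congr (_ *m _); rewrite mulmxDl !mulmxDr -!scalemxAl -!scalemxAr EE EF FE FF.
by rewrite !scaler0 addr0 add0r scalerA mulrC -normCK w1 expr1n scale1r.
Qed.

Lemma pid_copid_unitary m j (w : C) : (j <= m)%N -> `|w| = 1 ->
  isometric 1%:M (w *: pid_mx j + copid_mx j : 'M[C]_m).
Proof.
move=> jm; apply: isometric_reflection; first by rewrite pid_mx_id.
by rewrite tr_pid_mx map_pid_mx mulmx1 mul1mx.
Qed.

(** Comparing determinants, the scalar c must satisfy c^m det B = (c w)^j, which
    has a solution of modulus 1 as soon as j < m; when j = 0 and m = 0 there is
    nothing to solve.  The quotient of c B by the reflection then has determinant 1. *)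
Lemma scaled_unitary_factorization m j (B : 'M[C]_m) (w : C) :
  B ^t* *m B = 1%:M -> `|w| = 1 -> (j < m)%N \/ j = 0 ->
  exists c X Y, [/\ `|c| = 1, bireflectional 1%:M X, bireflectional 1%:M Y
    & c *: B = X *m Y *m (c * w *: pid_mx j + copid_mx j)].
Proof.
move=> BB w1 jm; have le_jm : (j <= m)%N by case: jm => [/ltnW|->].
have dB : `|\det B| = 1.
  have /eqP := congr1 determinant BB; rewrite det1 det_mulmx det_map_mx det_tr.
  by rewrite mulrC -normCK sqrp_eq1 // => /eqP.
have [c c1 cE] : exists2 c : C, `|c| = 1 & c ^+ m * \det B = (c * w) ^+ j.
  case: jm => [lt_jm|j0].
    have [||c c1 cE] := @root_of_unit_norm (m - j) (w ^+ j / \det B).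
    - by rewrite subn_gt0.
    - by rewrite normf_div normrX w1 dB expr1n divr1.
    exists c => //; have -> : c ^+ m = (c * w) ^+ j / \det B.
      by rewrite -{1}(subnKC le_jm) exprD cE exprMn mulrA.
    by rewrite mulfVK // -normr_gt0 dB.
  rewrite j0; case: m B BB dB {le_jm} => [|m] B BB dB.
    by exists 1; rewrite ?normr1 // det_mx00 !expr0 mulr1.
  have [||c c1 cE] := @root_of_unit_norm m.+1 (\det B)^-1 => //.
    by rewrite normfV dB invr1.
  by exists c => //; rewrite cE expr0 mulVf // -normr_gt0 dB.
have cw1 : `|c * w| = 1 by rewrite normrM c1 w1 mulr1.
pose S : 'M[C]_m := c * w *: pid_mx j + copid_mx j.
have SS : S ^t* *m S = 1%:M.
  by have := pid_copid_unitary le_jm cw1; rewrite /isometric mulmx1.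
have SS' := mulmx1C SS.
have dS : \det S = (c * w) ^+ j by apply: det_pid_copid.
(* S is unitary, so c B S^* is the quotient of c B by the reflection S. *)
have [||X [Y [hX hY E]]] := @bireflectional_unitary_factorization m (c *: B *m S ^t*).
- have cBcB : (c^* *: B ^t*) *m (c *: B) = 1%:M.
    by rewrite -scalemxAl -scalemxAr scalerA BB mulrC -normCK c1 expr1n scale1r.
  by rewrite trCM trmxCK trCZ !mulmxA -(mulmxA S) cBcB mulmx1.
- have := congr1 determinant SS'; rewrite det1 det_mulmx dS -cE => dSS.
  by rewrite det_mulmx detZ.
exists c, X, Y; split => //.
by rewrite -E -mulmxA SS mulmx1.
Qed.
End Bireflections.

(** * Complex reflections and products in PU(n,1) *)

Section Reflections.
Variables (C : numClosedFieldType) (n : nat).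
Local Notation V := 'cV[C]_n.+1.
Local Notation J := (Jmx C n).

Lemma JmxK : J *m J = 1%:M.
Proof.
rewrite /Jmx mulmx_diag -diag_const_mx; congr diag_mx; apply/rowP=> i.
by rewrite !mxE; case: ifP; rewrite ?mulrNN mulr1.
Qed.

Lemma trC_Jmx : J ^t* = J.
Proof.
rewrite trC_diag; congr diag_mx; apply/rowP=> i; rewrite !mxE.
by case: ifP; rewrite ?rmorphN ?rmorph1.
Qed.

Lemma lactE (A : 'M[C]_n.+1) (v : V) : lact A v = A *m v.
Proof. by rewrite lfunE. Qed.

Lemma herm_conj (u v : V) : herm v u = (herm u v)^*.
Proof.
have E : u ^t* *m J *m v = (v ^t* *m J *m u) ^t*.
  by rewrite !trCM trmxCK trC_Jmx mulmxA.
by rewrite /herm E !mxE.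
Qed.

Lemma Ugrp_of_isometric (A : 'M[C]_n.+1) : isometric J A ->
  {B : Ugrp C n | Uval B = A}.
Proof.
move=> hA; suff uA : unitary_pred A by exists (MkU uA).
apply/andP; split; last exact/eqP.
have : (J *m A^t* *m J) *m A = 1%:M by rewrite -!mulmxA (mulmxA _ J) hA JmxK.
by case/mulmx1_unit.
Qed.

Lemma scaled_lift (A : Ugrp C n) c : `|c| = 1 ->
  exists2 A' : Ugrp C n, Uval A' = c *: Uval A & piPU A = piPU A'.
Proof.
move=> c1; have hA : isometric J A := UE A.
have [A' A'E] : {A' : Ugrp C n | Uval A' = c *: Uval A}.
  apply: Ugrp_of_isometric; rewrite /isometric trCZ -!scalemxAl -scalemxAr scalerA hA.
  by rewrite mulrC -normCK c1 expr1n scale1r.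
by exists A' => //; apply/piPUP; exists c.
Qed.

(** The projection E = L M onto the eigenspace is given with a factorization
    through a space of dimension k+1, whose injection L computes the dimension
    of the image. *)
Lemma kreflection_of_projection (A : Ugrp C n) k (L : 'M_(n.+1, k.+1))
    (M : 'M_(k.+1, n.+1)) w v :
  M *m L = 1%:M -> (L *m M) ^t* *m J = J *m (L *m M) -> `|w| = 1 ->
  Uval A = w *: (L *m M) + (1%:M - L *m M) ->
  negative_vec v -> L *m M *m v = v -> kreflection k A.
Proof.
move=> ML; set E := L *m M => EJ w1 AE v0 Ev.
have EE : E *m E = E by rewrite /E mulmxA -(mulmxA L) ML mulmx1.
pose f : 'Hom('cV[C]_k.+1, V) := linfun (mulmx L).
pose U := limg f; pose W := limg (lact (1%:M - E)).
have UP u : reflect (E *m u = u) (u \in U).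
  apply: (iffP memv_imgP) => [[x _ ->]|<-].
    by rewrite lfunE /= /E !mulmxA -(mulmxA L) ML mulmx1.
  by exists (M *m u); rewrite ?memvf // lfunE /= mulmxA.
have WP u : reflect (E *m u = 0) (u \in W).
  apply: (iffP memv_imgP) => [[x _ ->]|Eu].
    by rewrite lactE mulmxA mulmxBr mulmx1 EE subrr mul0mx.
  by exists u; rewrite ?memvf // lactE mulmxBl mul1mx Eu subr0.
have orth u x : u \in U -> x \in W -> herm u x = 0.
  move=> /UP <- /WP Ex; rewrite /herm.
  have -> : x ^t* *m J *m (E *m u) = (E *m x) ^t* *m J *m u.
    by rewrite trCM -(mulmxA _ (E ^t*)) EJ !mulmxA.
  by rewrite Ex trC0 !mul0mx mxE.
have UW : (U + W)%VS = fullv.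
  apply/eqP; rewrite eqEsubv subvf; apply/subvP=> x _.
  rewrite -[x](subrK (E *m x)) addrC memv_add //.
    by apply/UP; rewrite mulmxA EE.
  by apply/WP; rewrite mulmxBr mulmxA EE subrr.
exists U, W, w; split; split => //.
- split => //; apply/directv_addP/eqP; rewrite -subv0; apply/subvP=> x.
  by rewrite memv_cap memv0 => /andP[/UP Ex /WP E0]; rewrite -Ex E0.
- rewrite /U limg_dim_eq ?dimvf ?dim_matrix; first exact: muln1.
  apply/eqP; rewrite capfv -subv0; apply/subvP=> x; rewrite memv_ker lfunE /= memv0.
  by move=> /eqP Lx; rewrite -[x]mul1mx -ML -mulmxA Lx mulmx0.
- move=> [x xU [x0 xo]]; case/eqP: x0.
  have xo' y : herm x y = 0.
    have : y \in (U + W)%VS by rewrite UW memvf.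
    case/memv_addP=> a aU [b bW ->]; rewrite /herm trCD !mulmxDl mxE.
    by have := orth _ _ xU bW; have := xo _ aU; rewrite /herm => -> ->; rewrite addr0.
  have Jx : J *m x = 0.
    apply/colP=> i; have := xo' (delta_mx i 0); rewrite /herm -mulmxA.
    rewrite trmx_delta map_delta_mx -rowE !mxE => ->//.
  by rewrite -[x]mul1mx -JmxK -mulmxA Jx mulmx0.
- by exists v => //; apply/UP.
- by move=> u /UP Eu; rewrite lactE AE mulmxDl mulmxBl -scalemxAl mul1mx Eu subrr addr0.
move=> x /WP Ex; rewrite lactE AE mulmxDl mulmxBl -scalemxAl mul1mx Ex scaler0.
by rewrite add0r subr0.
Qed.

Lemma inv4_reflection_of_factorization (A R : Ugrp C n) X Y k :
  bireflectional J X -> bireflectional J Y -> kreflection k R ->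
  Uval A = X *m Y *m Uval R -> inv4_reflection k (piPU A).
Proof.
move=> [I1 [I2 [h1 i1 h2 i2 ->]]] [I3 [I4 [h3 i3 h4 i4 ->]]] hR AE.
have [[B1 E1] [B2 E2]] := (Ugrp_of_isometric h1, Ugrp_of_isometric h2).
have [[B3 E3] [B4 E4]] := (Ugrp_of_isometric h3, Ugrp_of_isometric h4).
have invol B : Uval B *m Uval B = 1%:M -> involution (piPU B : PU C n).
  move=> BB; rewrite /involution expgS expg1.
  transitivity (piPU (Umul B B)); first exact: piPU_mul.
  by congr piPU; apply: val_inj.
exists [:: piPU B1; piPU B2; piPU B3; piPU B4], (piPU R); split => //.
- move=> g; rewrite !inE => /or4P[] /eqP->; apply: invol;
    by rewrite ?E1 ?E2 ?E3 ?E4.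
- by exists R.
rewrite !big_cons big_nil mulg1.
have piM B D : (piPU B * piPU D)%g = piPU (Umul B D) :> PU C n by apply: piPU_mul.
rewrite !piM; congr piPU; apply: val_inj.
by rewrite /= AE E1 E2 E3 E4 !mulmxA.
Qed.

End Reflections.

(** * Frames adapted to an orthogonal decomposition *)

Lemma mulmx1C_eq (K : comUnitRingType) p N (A : 'M[K]_(p, N)) B :
  p = N -> A *m B = 1%:M -> B *m A = 1%:M.
Proof. by move=> e; case: _ / e A B => A B; apply: mulmx1C. Qed.

Section Frames.
Variables (C : numClosedFieldType) (n : nat).
Local Notation N := n.+1.
Local Notation J := (Jmx C n).

(** A unitary matrix has all its eigenvalues on the unit circle. *)
Lemma unitary_sub_scalar_unit m (B : 'M[C]_m) (mu : C) :
  B ^t* *m B = 1%:M -> `|mu| != 1 -> B - mu%:M \in unitmx.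
Proof.
move=> BB mu1; rewrite -row_free_unit -kermx_eq0 -[_ == 0]negbK.
apply/negP => /eigenvalueP[v vB v0]; have := dotmx_is_dotmx v0.
rewrite dotmxE => vv; have : (v *m B) *m (v *m B) ^t* = v *m v ^t*.
  by rewrite trCM mulmxA -(mulmxA v) (mulmx1C BB) mulmx1.
rewrite vB trCZ -scalemxAl -scalemxAr scalerA -normCK.
move=> /matrixP /(_ 0 0); rewrite mxE -[RHS]mul1r => /(mulIf (lt0r_neq0 vv)) /eqP.
by rewrite sqrp_eq1 // (negPf mu1).
Qed.

Lemma trC_form p q (a : 'M[C]_(N, p)) (b : 'M_(N, q)) :
  (a ^t* *m J *m b) ^t* = b ^t* *m J *m a.
Proof. by rewrite !trCM trmxCK trC_Jmx mulmxA. Qed.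

Lemma pid_mx_block_id p m j :
  pid_mx (p + j) = block_mx 1%:M 0 0 (pid_mx j) :> 'M[C]_(p + m).
Proof.
apply/matrixP=> i k; rewrite mxE; case: (split_ordP i) => i' ->;
  case: (split_ordP k) => k' ->;
  rewrite ?block_mxEul ?block_mxEur ?block_mxEdl ?block_mxEdr !mxE /=.
- by rewrite ltn_addr // andbT.
- by rewrite ltn_eqF // ltn_addr.
- by rewrite gtn_eqF // ltn_addr.
by rewrite eqn_add2l ltn_add2l.
Qed.

(** Together f and w are a basis in which the form is block diagonal with
    blocks H and 1; H will be -1 or a hyperbolic plane. *)
Definition frame q m (H : 'M[C]_q) (f : 'M[C]_(N, q)) (w : 'M[C]_(N, m)) :=
  [/\ f ^t* *m J *m f = H, w ^t* *m J *m w = 1%:M & f ^t* *m J *m w = 0].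

Section OneFrame.
Variables (q m : nat) (H : 'M[C]_q) (f : 'M[C]_(N, q)) (w : 'M[C]_(N, m)).
Hypotheses (HH : H *m H = 1%:M) (Hh : H ^t* = H) (fr : frame H f w).
Local Notation P := (row_mx f w).
Local Notation G := (block_mx H 0 0 (1%:M : 'M[C]_m)).

Lemma frame_form : P ^t* *m J *m P = G.
Proof.
case: fr => ff ww fw; have wf : w ^t* *m J *m f = 0 by rewrite -trC_form fw trC0.
by rewrite trC_row mul_col_mx mul_col_row ff ww fw wf.
Qed.

Lemma frame_formK : G *m G = 1%:M.
Proof.
by rewrite mulmx_block !(mulmx0, mul0mx, addr0, add0r) HH mulmx1 -scalar_mx_block.
Qed.

Lemma frame_inv : N = (q + m)%N ->
  exists2 Q : 'M[C]_(q + m, N), Q *m P = 1%:M & P *m Q = 1%:M.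
Proof.
move=> Nqm; have QP : (G *m P ^t* *m J) *m P = 1%:M.
  by rewrite -!mulmxA (mulmxA (P^t*)) frame_form frame_formK.
by exists (G *m P ^t* *m J) => //; apply: mulmx1C_eq QP.
Qed.

Lemma frame_expand p (u : 'M[C]_(N, p)) : N = (q + m)%N ->
  u = f *m H *m (f ^t* *m J *m u) + w *m (w ^t* *m J *m u).
Proof.
case/frame_inv=> Q QP PQ; have QE : Q = G *m P ^t* *m J.
  by rewrite -[RHS]mulmx1 -PQ mulmxA -(mulmxA _ J) -(mulmxA G) (mulmxA (P^t*))
    frame_form frame_formK mul1mx.
rewrite -[LHS]mul1mx -PQ QE trC_row mul_block_col !(mul0mx, addr0, add0r) mul1mx.
by rewrite !mulmxA mul_row_col !mulmxDl !mulmxA.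
Qed.

(** The reflection acts by c on the span of f and of the first j columns of w;
    x gives the coordinates of a negative vector in the span of f. *)
Lemma frame_reflection (Q : 'M[C]_(q + m, N)) j k (x : 'cV[C]_q) (c : C) :
  Q *m P = 1%:M -> P *m Q = 1%:M ->
  `|c| = 1 -> (j <= m)%N -> (q + j)%N = k.+1 -> (x ^t* *m H *m x) 0 0 < 0 ->
  exists2 R : Ugrp C n, kreflection k R &
    Uval R = P *m block_mx c%:M 0 0 (c *: pid_mx j + copid_mx j) *m Q.
Proof.
move=> QP PQ c1 jm qj x0.
pose L : 'M[C]_(N, k.+1) := P *m pid_mx k.+1.
pose M : 'M[C]_(k.+1, N) := pid_mx k.+1 *m Q.
have le_k : (k.+1 <= q + m)%N by rewrite -qj leq_add2l.
have ML : M *m L = 1%:M.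
  rewrite /M /L mulmxA -(mulmxA _ Q) QP mulmx1 mul_pid_mx !minnn.
  by rewrite (minn_idPr le_k) pid_mx_1.
pose E : 'M[C]_(q + m) := block_mx 1%:M 0 0 (pid_mx j).
have pidE : pid_mx k.+1 = E by rewrite -qj /E; apply: pid_mx_block_id.
have LME : L *m M = P *m E *m Q.
  by rewrite /L /M mulmxA -(mulmxA P) pid_mx_id // pidE.
have Emap : (P *m E *m Q) ^t* *m J = J *m (P *m E *m Q).
  have GE : G *m E = E *m G.
    by rewrite !mulmx_block !(mulmx0, mul0mx, addr0, add0r) !(mul1mx, mulmx1).
  have Et : E ^t* = E by rewrite trC_block !trC0 trC1 tr_pid_mx map_pid_mx.
  have PJ : P ^t* *m J = G *m Q by rewrite -frame_form -mulmxA PQ mulmx1.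
  have JP : J *m P = Q ^t* *m G.
    have Gt : G ^t* = G by rewrite trC_block !trC0 trC1 Hh.
    by rewrite -[LHS]trmxCK trCM trC_Jmx PJ trCM Gt.
  by rewrite !trCM Et -!mulmxA PJ !mulmxA JP -[Q ^t* *m G *m E]mulmxA GE mulmxA.
have [B BE] : {B : Ugrp C n | Uval B = c *: (L *m M) + (1%:M - L *m M)}.
  apply: Ugrp_of_isometric; apply: isometric_reflection => //.
    by rewrite mulmxA -(mulmxA L) ML mulmx1.
  by rewrite LME.
exists B; last first.
  rewrite BE LME -{1}PQ -[in P *m Q](mulmx1 P) scalemxAl scalemxAr.
  rewrite -mulmxBl -mulmxBr -mulmxDl -mulmxDr.
  congr (_ *m _ *m _); rewrite /E scalar_mx_block scale_block_mx opp_block_mx.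
  rewrite !add_block_mx.
  by rewrite !scaler0 !oppr0 !addr0 subrr addr0 scalemx1.
apply: (kreflection_of_projection (v := f *m x) ML _ c1 BE); first by rewrite LME.
  case: fr => ff _ _; rewrite /negative_vec /herm trCM.
  by rewrite mulmxA -(mulmxA (x^t*)) -(mulmxA (x^t*)) ff.
rewrite LME; have -> : f *m x = P *m col_mx x 0 by rewrite mul_row_col mulmx0 addr0.
rewrite -!mulmxA (mulmxA Q) QP mul1mx mul_block_col.
by rewrite !(mulmx0, mul0mx, addr0, add0r) mul1mx.
Qed.

(** The first bireflectional factor X is not given in the coordinates of the frame,
    because in the boundary case it is diagonal in another one. *)
Lemma inv4_reflection_of_frame (Q : 'M[C]_(q + m, N)) j k (x : 'cV[C]_q) (c : C)
    (A : Ugrp C n) X D Y :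
  Q *m P = 1%:M -> P *m Q = 1%:M ->
  `|c| = 1 -> (j <= m)%N -> (q + j)%N = k.+1 -> (x ^t* *m H *m x) 0 0 < 0 ->
  bireflectional J X -> bireflectional H D -> bireflectional 1%:M Y ->
  Uval A *m P = X *m P *m block_mx (c *: D) 0 0 (Y *m (c *: pid_mx j + copid_mx j)) ->
  inv4_reflection k (piPU A).
Proof.
move=> QP PQ c1 jm qj x0 hX hD hY AE.
have [R hR RE] := frame_reflection QP PQ c1 jm qj x0.
have hZ := bireflectional_base_change frame_form PQ QP (bireflectional_block hD hY).
apply: (inv4_reflection_of_factorization hX hZ hR).
rewrite RE -[LHS]mulmx1 -PQ mulmxA AE !mulmxA.
rewrite -(mulmxA _ Q P) QP mulmx1 -(mulmxA _ (block_mx D _ _ _)) mulmx_block.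
by rewrite !(mulmx0, mul0mx, addr0, add0r) mul_mx_scalar -!mulmxA.
Qed.

End OneFrame.

Lemma isometric_eigenvector_left (A : 'M[C]_N) p (f : 'M[C]_(N, p)) l :
  isometric J A -> A *m f = l *: f -> l != 0 -> f ^t* *m J *m A = l^*^-1 *: (f ^t* *m J).
Proof.
move=> hA Af l0; have : (A *m f) ^t* *m J *m A = f ^t* *m J.
  by rewrite trCM -[in RHS]hA !mulmxA.
rewrite Af trCZ -!scalemxAl => E.
by rewrite -[in RHS]E scalerA mulVf ?scale1r // conjC_eq0.
Qed.

Lemma form_mul p q r s (a : 'M[C]_(N, p)) (b : 'M_(N, q)) (X : 'M_(p, r)) (Y : 'M_(q, s)) :
  (a *m X) ^t* *m J *m (b *m Y) = X ^t* *m (a ^t* *m J *m b) *m Y.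
Proof. by rewrite trCM !mulmxA. Qed.

Lemma unitary_diagonal_block (A : 'M[C]_N) p m (f : 'M[C]_(N, p)) (w : 'M[C]_(N, m)) B a :
  isometric J A -> f ^t* *m J *m f = 0 -> f ^t* *m J *m w = 0 -> w ^t* *m J *m w = 1%:M ->
  A *m w = w *m B + f *m a -> B ^t* *m B = 1%:M.
Proof.
move=> hA ff fw ww Aw; have wf : w ^t* *m J *m f = 0 by rewrite -trC_form fw trC0.
have : (A *m w) ^t* *m J *m (A *m w) = w ^t* *m J *m w.
  exact: isometric_form.
rewrite ww => <-; rewrite Aw trCD !mulmxDl !mulmxDr !form_mul ff fw ww wf.
by rewrite !(mulmx0, mul0mx, addr0) mulmx1.
Qed.

(** A is block diagonal in the frame, with blocks l and a unitary matrix; the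
    first bireflectional factor is the identity on v. *)
Lemma elliptic_frame_factorization (A : Ugrp C n) (v : 'cV[C]_N) (w : 'M_(N, n)) l j :
  frame (-1)%:M v w -> Uval A *m v = l *: v -> (j < n)%N \/ j = 0 ->
  inv4_reflection j (piPU A).
Proof.
move=> fr Av jn; have [vv ww vw] := fr.
have hA : isometric J A := UE A.
have vvN : (-1)%:M != 0 :> 'M[C]_1.
  by apply/eqP=> /matrixP /(_ 0 0); rewrite !mxE => /eqP; rewrite oppr_eq0 oner_eq0.
have l1 : `|l| = 1.
  have : (Uval A *m v) ^t* *m J *m (Uval A *m v) = v ^t* *m J *m v.
    exact: isometric_form.
  rewrite Av trCZ -!scalemxAl -scalemxAr scalerA vv mulrC -normCK => /matrixP /(_ 0 0).
  rewrite !mxE /= mulr1n -[RHS]mul1r => /(mulIf _) /eqP.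
  rewrite oppr_eq0 oner_eq0 sqrp_eq1 //.
  by move=> /(_ isT) /eqP.
have l0 : l != 0 by rewrite -normr_gt0 l1.
have HH : (-1)%:M *m (-1)%:M = 1%:M :> 'M[C]_1 by rewrite -scalar_mxM mulrNN mulr1.
have Hh : ((-1)%:M : 'M[C]_1) ^t* = (-1)%:M.
  by rewrite tr_scalar_mx map_scalar_mx rmorphN rmorph1.
have vAw : v ^t* *m J *m (Uval A *m w) = 0.
  by rewrite mulmxA (isometric_eigenvector_left hA Av l0) -scalemxAl vw scaler0.
have Aw : Uval A *m w = w *m (w ^t* *m J *m (Uval A *m w)).
  by rewrite {1}(frame_expand HH fr (Uval A *m w) erefl) vAw mulmx0 add0r.
set B := w ^t* *m J *m _ in Aw.
have BB : B ^t* *m B = 1%:M.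
  have : (Uval A *m w) ^t* *m J *m (Uval A *m w) = w ^t* *m J *m w.
    exact: isometric_form.
  by rewrite Aw form_mul ww mulmx1.
have [c [X [Y [c1 hX hY E]]]] := scaled_unitary_factorization BB l1 jn.
have [A' A'E ->] := scaled_lift A c1.
have [Q QP PQ] := frame_inv HH fr erefl.
have hX' := bireflectional_base_change (frame_form fr) PQ QP
  (bireflectional_block (bireflectional1 (-1)%:M) hX).
have e1 : (1 + j = j.+1)%N by [].
have main := inv4_reflection_of_frame (x := 1%:M) Hh fr QP PQ _ _ e1 _ hX'
  (bireflectional1 _) hY.
apply: (main (c * l)).
- by rewrite normrM c1 l1 mulr1.
- by case: jn => [/ltnW|->].
- by rewrite trC1 mul1mx mulmx1 mxE /= mulr1n oppr_lt0 ltr01.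
rewrite -(mulmxA _ Q) QP mulmx1 -mulmxA mulmx_block !(mulmx0, mul0mx, addr0, add0r) mul1mx.
rewrite mul_row_block !(mulmx0, addr0, add0r) (mulmxA X Y) -E A'E mul_mx_row.
by rewrite -!scalemxAl Av Aw scalerA -!scalemxAr mulmx1.
Qed.

End Frames.

(** * Isometries fixing a null line *)

Section Boundary.
Variables (C : numClosedFieldType) (n : nat).
Local Notation N := n.+1.
Local Notation J := (Jmx C n).

Definition hyperbolic_plane : 'M[C]_(1 + 1) := block_mx 0 1%:M 1%:M 0.
Local Notation H2 := hyperbolic_plane.

(** In a basis of null vectors with product 1, and for r > 0, this is a
    translation along the geodesic joining them. *)
Definition boost (r : C) : 'M[C]_(1 + 1) := block_mx r%:M 0 0 r^-1%:M.

Lemma hyperbolic_planeK : H2 *m H2 = 1%:M.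
Proof.
by rewrite mulmx_block !(mulmx0, mul0mx, addr0, add0r, mulmx1) -scalar_mx_block.
Qed.

Lemma trC_hyperbolic_plane : H2 ^t* = H2.
Proof. by rewrite trC_block !trC0 trC1. Qed.

Lemma boost_bireflectional r : r \is Num.real -> r != 0 -> bireflectional H2 (boost r).
Proof.
move=> rR r0; exists (block_mx 0 r%:M r^-1%:M 0), H2.
have rC : r^* = r by apply/CrealP.
split.
- rewrite /isometric trC_block !trC0 !tr_scalar_mx !map_scalar_mx /= fmorphV /= rC.
  rewrite !mulmx_block !(mulmx0, mul0mx, addr0, add0r, mulmx1, mul1mx).
  by rewrite -!scalar_mxM mulVf // mulfV.
- rewrite mulmx_block !(mulmx0, mul0mx, addr0, add0r) -!scalar_mxM mulVf // mulfV //.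
  by rewrite -scalar_mx_block.
- by rewrite /isometric trC_hyperbolic_plane hyperbolic_planeK mul1mx.
- exact: hyperbolic_planeK.
by rewrite mulmx_block !(mulmx0, mul0mx, addr0, add0r, mulmx1).
Qed.

Definition null_frame m (f g : 'cV[C]_N) (w : 'M[C]_(N, m)) :=
  [/\ f ^t* *m J *m f = 0, f ^t* *m J *m g = 1%:M & g ^t* *m J *m g = 0] /\
  [/\ w ^t* *m J *m w = 1%:M, f ^t* *m J *m w = 0 & g ^t* *m J *m w = 0].

Lemma null_frameP m (f g : 'cV[C]_N) (w : 'M[C]_(N, m)) :
  null_frame f g w -> frame H2 (row_mx f g) w.
Proof.
move=> [[ff fg gg] [ww fw gw]]; split => //; last first.
  by rewrite trC_row !mul_col_mx fw gw col_mx0.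
have gf : g ^t* *m J *m f = 1%:M by rewrite -trC_form fg trC1.
by rewrite trC_row !mul_col_mx !mul_mx_row ff fg gg gf.
Qed.

Lemma null_frame_expand m (f g : 'cV[C]_N) (w : 'M[C]_(N, m)) p (u : 'M[C]_(N, p)) :
  N = (1 + 1 + m)%N -> null_frame f g w ->
  u = f *m (g ^t* *m J *m u) + g *m (f ^t* *m J *m u) + w *m (w ^t* *m J *m u).
Proof.
move=> Nm /null_frameP fr.
rewrite {1}(frame_expand hyperbolic_planeK fr u Nm) trC_row !mul_col_mx.
by rewrite mul_row_block !(mulmx0, addr0, add0r, mulmx1) mul_row_col [X in X + _]addrC.
Qed.

Section FixedNullLine.
Variables (m : nat) (A : 'M[C]_N) (f g : 'cV[C]_N) (w : 'M[C]_(N, m)) (l : C).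
Hypotheses (Nm : N = (1 + 1 + m)%N) (hA : isometric J A) (fr : null_frame f g w).
Hypotheses (Af : A *m f = l *: f) (l0 : l != 0).

(** A preserves the orthogonal complement of its eigenvector f, which is the
    span of f and w. *)
Lemma null_frame_block :
  A *m w = w *m (w ^t* *m J *m (A *m w)) + f *m (g ^t* *m J *m (A *m w)).
Proof.
case: (fr) => [[ff fg gg] [ww fw gw]].
rewrite {1}(null_frame_expand (A *m w) Nm fr) [f^t* *m J *m (A *m w)]mulmxA.
rewrite (isometric_eigenvector_left hA Af l0) -scalemxAl fw scaler0 mulmx0 addr0.
by rewrite addrC.
Qed.

Lemma null_frame_block_unitary (B := w ^t* *m J *m (A *m w)) : B ^t* *m B = 1%:M.
Proof.
case: fr => [[ff fg gg] [ww fw gw]].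
exact: unitary_diagonal_block hA ff fw ww null_frame_block.
Qed.

(** The eigenvalues of A are l, those of the unitary block B, and mu = 1 / conj(l).
    The moduli of l and mu differ from 1, so l, B and mu have disjoint
    spectra, and the triangular A can be diagonalized by adding to w a multiple
    of f, and to g a combination of w and f.  The new vectors are again a null
    frame, since eigenvectors for a and b are orthogonal when a conj(b) is
    not 1. *)
Lemma null_frame_diagonalize : `|l| != 1 ->
  exists g' w', [/\ null_frame f g' w', A *m g' = l^*^-1 *: g' &
    A *m w' = w' *m (w ^t* *m J *m (A *m w))].
Proof.
move=> l1; have BB := null_frame_block_unitary; have Aw := null_frame_block.
have := null_frame_expand (A *m g) Nm fr.
rewrite [f^t* *m J *m (A *m g)]mulmxA (isometric_eigenvector_left hA Af l0).
set B := w ^t* *m J *m (A *m w) in Aw BB *; set a := g ^t* *m J *m (A *m w) in Aw.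
case: (fr) => [[ff fg gg] [ww fw gw]].
set mu := l^*^-1; rewrite -[_ *: _ *m g]scalemxAl fg -scalemxAr mulmx1.
set s := g ^t* *m J *m (A *m g); set b := w ^t* *m J *m (A *m g) => Ag.
have mu1 : `|mu| != 1 by rewrite normfV norm_conjC invr_eq1.
have lmu : l - mu != 0.
  rewrite subr_eq0; apply: contra l1 => /eqP lmu.
  have := mulfV (_ : l^* != 0); rewrite conjC_eq0 => /(_ l0).
  by rewrite -/mu -lmu mulrC -normCK => /eqP; rewrite sqrp_eq1.
have Bl := unitary_sub_scalar_unit BB l1; have Bmu := unitary_sub_scalar_unit BB mu1.
(* Each correction solves a Sylvester equation between two of the blocks. *)
have [z zE] : exists z, z *m B = a + l *: z.
  exists (a *m invmx (B - l%:M)); set z := a *m _.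
  by rewrite -[a](mulmxKV Bl) -/z mulmxBr mul_mx_scalar subrK.
pose w' := w + f *m z.
have Aw' : A *m w' = w' *m B.
  rewrite /w' mulmxDr mulmxDl Aw mulmxA Af -(mulmxA f) zE mulmxDr -scalemxAl -scalemxAr.
  by rewrite addrA.
have [y yE] : exists y, B *m y + b = mu *: y.
  exists (- (invmx (B - mu%:M) *m b)); set y := - _.
  have : (B - mu%:M) *m y = - b by rewrite mulmxN mulKVmx.
  rewrite mulmxBl mul_scalar_mx => /eqP; rewrite subr_eq => /eqP->.
  by rewrite addrAC addNr add0r.
have [x xE] : exists x, s + a *m y + l *: x = mu *: x.
  exists (- (l - mu)^-1 *: (s + a *m y)); apply/eqP.
  by rewrite -subr_eq0 -addrA -scalerBl scalerA mulrN mulfV // scaleN1r subrr.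
pose g' := g + w *m y + f *m x.
have Ag' : A *m g' = mu *: g'.
  have Awy : A *m (w *m y) = w *m (B *m y) + f *m (a *m y).
    by rewrite mulmxA Aw mulmxDl -!mulmxA.
  have Afx : A *m (f *m x) = f *m (l *: x) by rewrite mulmxA Af -scalemxAl -scalemxAr.
  rewrite /g' !mulmxDr Ag Awy Afx !scalerDr (scalemxAr mu w) -yE (scalemxAr mu f) -xE.
  by rewrite !mulmxDr [LHS](AC (3*2*1) (2*(4*3)*(1*5*6))).
have fw' : f ^t* *m J *m w' = 0 by rewrite mulmxDr fw mulmxA ff mul0mx addr0.
have fg' : f ^t* *m J *m g' = 1%:M.
  by rewrite !mulmxDr fg !mulmxA fw ff !mul0mx !addr0.
have wf : w ^t* *m J *m f = 0 by rewrite -trC_form fw trC0.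
have ww' : w' ^t* *m J *m w' = 1%:M.
  rewrite {2}/w' mulmxDr mulmxA -(trC_form f) fw' trC0 mul0mx addr0.
  by rewrite trCD !mulmxDl ww trCM -!mulmxA (mulmxA (f^t*)) fw mulmx0 addr0.
exists g', w'; split => //; split; split => //.
- (* g' is null since its eigenvalue mu does not have modulus 1 *)
  have : (A *m g') ^t* *m J *m (A *m g') = g' ^t* *m J *m g'.
    exact: isometric_form.
  rewrite Ag' trCZ -!scalemxAl -scalemxAr scalerA mulrC -normCK.
  move/eqP; rewrite -subr_eq0 -{2}[g'^t* *m _ *m _]scale1r -scalerBl scaler_eq0.
  by rewrite subr_eq0 sqrp_eq1 // (negPf mu1) => /eqP.
have : (A *m w') ^t* *m J *m (A *m g') = w' ^t* *m J *m g'.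
  exact: isometric_form.
rewrite Ag' Aw' -scalemxAr trCM -!(mulmxA (B ^t*)).
move: (w' ^t* *m J *m g') (trC_form w' g') => X Xt E; have : (B - mu%:M) *m X = 0.
  by rewrite mulmxBl -{1}E -scalemxAr mulmxA (mulmx1C BB) mul1mx mul_scalar_mx subrr.
move/(congr1 (mulmx (invmx (B - mu%:M)))); rewrite mulKmx // mulmx0 => wg.
by rewrite -Xt wg trC0.
Qed.

End FixedNullLine.

Lemma mul_row_boost (f g : 'cV[C]_N) r :
  row_mx f g *m boost r = row_mx (r *: f) (r^-1 *: g).
Proof. by rewrite mul_row_block !(mulmx0, addr0, add0r) !mul_mx_scalar. Qed.

(** A is rescaled so that its unitary block is X Y S, and multiplied by the inverse
    of the bireflectional isometry U that acts by 2|l|, X, 1/(2|l|) in the frame.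
    The factor 2 moves the eigenvalue at f off the unit circle, so the result M
    is diagonal in another frame with the same f. *)
Lemma boundary_frame_factorization (A : Ugrp C n) m f g (w : 'M_(N, m)) l j :
  N = (1 + 1 + m)%N -> null_frame f g w -> Uval A *m f = l *: f -> l != 0 ->
  (j < m)%N \/ j = 0 -> inv4_reflection j.+1 (piPU A).
Proof.
move=> Nm fr Af l0 jm; have hA : isometric J A := UE A.
have BB := null_frame_block_unitary Nm hA fr Af l0.
have Aw := null_frame_block Nm hA fr Af l0.
set B := w ^t* *m J *m (Uval A *m w) in BB Aw; set a := g ^t* *m J *m _ in Aw.
have nl0 : 0 < `|l| by rewrite normr_gt0.
pose om := l / `|l|; have om1 : `|om| = 1.
  by rewrite normf_div normr_id divff // lt0r_neq0.
have [c [X [Y [c1 hX hY E]]]] := scaled_unitary_factorization BB om1 jm.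
have [A' A'E ->] := scaled_lift A c1.
have [[ff fg gg] [ww fw gw]] := fr.
have hf := null_frameP fr.
have [Q QP PQ] := frame_inv hyperbolic_planeK hf Nm.
(* any positive multiple of |l| other than |l| itself would do *)
pose r := 2 * `|l|; have r0 : r != 0 by rewrite mulf_neq0 ?pnatr_eq0 ?lt0r_neq0.
have rR : r \is Num.real by rewrite realM ?realn ?normr_real.
set S := _ + _ in E.
have XX : X ^t* *m X = 1%:M.
  by have := isometric_bireflectional hX; rewrite /isometric mulmx1.
have hX1 := bireflectional_base_change (frame_form hf) PQ QP
  (bireflectional_block (boost_bireflectional rR r0) hX).
have [U UE1] := Ugrp_of_isometric (isometric_bireflectional hX1).
have : Uval U *m row_mx (row_mx f g) w = row_mx (row_mx (r *: f) (r^-1 *: g)) (w *m X).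
  rewrite UE1 -(mulmxA _ Q) QP mulmx1 mul_row_block !(mulmx0, addr0, add0r).
  by rewrite mul_row_boost.
rewrite -UE1 in hX1; rewrite !mul_mx_row => /eq_row_mx [/eq_row_mx[Uf _] Uw].
have [M ME] : exists M : Ugrp C n, Uval M = invmx (Uval U) *m Uval A'.
  by exists (Umul (Uinv U) A').
have UM : Uval U *m Uval M = Uval A' by rewrite ME mulKVmx ?Uunit.
have Vf : invmx (Uval U) *m f = r^-1 *: f.
  by rewrite -{1}[f](scalerK r0) -Uf -scalemxAr mulKmx ?Uunit.
have Vw : invmx (Uval U) *m w = w *m X ^t*.
  rewrite -{1}[w]mulmx1 -(mulmx1C XX) !mulmxA -(mulmxA _ w) -Uw !mulmxA.
  by rewrite mulVmx ?Uunit ?mul1mx.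
have Mf : Uval M *m f = (c * om / 2) *: f.
  rewrite ME A'E -mulmxA -scalemxAl Af -!scalemxAr Vf !scalerA /om /r.
  by congr (_ *: _); rewrite invfM !mulrA; ring.
have Mw : Uval M *m w = w *m (Y *m S) + f *m (r^-1 * c *: a).
  rewrite ME A'E -mulmxA -scalemxAl Aw scalerDr mulmxDr scalemxAr E -!scalemxAr.
  rewrite (mulmxA (invmx U) w) (mulmxA (invmx U) f) Vw Vf -scalemxAl scalerA.
  rewrite [c * _]mulrC; congr (_ + _).
  by rewrite -!mulmxA (mulmxA (X^t*)) XX mul1mx.
have com1 : `|c * om| = 1 by rewrite normrM c1 om1 mulr1.
have Ml : `|c * om / 2| != 1.
  by rewrite normf_div com1 normr_nat div1r invr_eq1 -[1]/(1%:R) eqr_nat.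
have Ml0 : c * om / 2 != 0.
  by rewrite mulf_neq0 ?invr_eq0 ?pnatr_eq0 // -normr_gt0 com1.
have [g' [w' [fr' Mg' Mw']]] := null_frame_diagonalize Nm (UE M) fr Mf Ml0 Ml.
have Bw : w ^t* *m J *m (Uval M *m w) = Y *m S.
  have wf : w ^t* *m J *m f = 0 by rewrite -trC_form fw trC0.
  by rewrite Mw mulmxDr !mulmxA ww wf mul1mx mul0mx addr0.
rewrite Bw in Mw'.
have mu : (c * om / 2)^*^-1 = c * om * 2.
  have cc : (c * om)^* = (c * om)^-1 by rewrite invC_norm com1 expr1n invr1 mul1r.
  by rewrite rmorphM /= cc fmorphV /= conjC_nat invfM !invrK.
have hf' := null_frameP fr'.
have [Q' QP' PQ'] := frame_inv hyperbolic_planeK hf' Nm.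
have half : (2^-1 : C) \is Num.real by rewrite realV realn.
have half0 : 2^-1 != 0 :> C by rewrite invr_eq0 pnatr_eq0.
have e1 : (1 + 1 + j = j.+2)%N by [].
have main := inv4_reflection_of_frame (x := col_mx 1%:M (- 1%:M))
  trC_hyperbolic_plane hf' QP' PQ' _ _ e1 _ hX1 (boost_bireflectional half half0) hY.
apply: (main (c * om)) => //.
- by case: jm => [/ltnW|->].
- rewrite tr_col_mx map_row_mx mul_row_block !(mulmx0, addr0, add0r) !mulmx1 mul_row_col.
  rewrite linearN /= map_mxN trC1 !(mulmxN, mulmx1) !mxE /= -opprD oppr_lt0.
  by rewrite addr_gt0 ?ltr01.
rewrite -UM -!mulmxA; congr (_ *m _).
rewrite mul_row_block !(mulmx0, addr0, add0r) -scalemxAr mul_row_boost !mul_mx_row.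
by rewrite Mf Mg' Mw' mu scale_row_mx !scalerA invrK.
Qed.

End Boundary.

(** * Existence of frames *)

Section FrameExistence.
Variables (C : numClosedFieldType).

(** This is the reflection in x + y, which sends x to -y because x and y have the
    same norm and a real product. *)
Lemma householder N (H : 'M[C]_N) (x y : 'cV[C]_N) :
  H ^t* = H -> x ^t* *m H *m x = y ^t* *m H *m y ->
  x ^t* *m H *m y = y ^t* *m H *m x -> (x + y) ^t* *m H *m (x + y) != 0 ->
  exists2 R, isometric H R & R *m x = - y.
Proof.
move=> Hh xx xy; set u := x + y; set D := _ *m u => D0.
pose d := D 0 0; have DE : D = d%:M by rewrite [D]mx11_scalar.
have d0 : d != 0 by apply: contra D0 => /eqP dd; rewrite DE dd raddf0.
have dC : d^* = d.
  have Dt : D ^t* = D by rewrite /D !trCM trmxCK Hh mulmxA.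
  by rewrite /d -{2}Dt !mxE.
pose e := 2 / d; have eC : e^* = e by rewrite /e rmorphM /= fmorphV /= dC conjC_nat.
have ed : e * d = 2 by rewrite /e mulfVK.
pose K := u *m u ^t* *m H.
have KH : K ^t* *m H = H *m K by rewrite /K !trCM trmxCK Hh !mulmxA.
have KK : K *m K = d *: K.
  rewrite /K -!mulmxA (mulmxA (u ^t*) H) (mulmxA (u ^t* *m H)) -/D DE mul_scalar_mx.
  by rewrite -!scalemxAr.
exists (1%:M - e *: K).
  rewrite /isometric trCB trC1 trCZ eC mulmxBl mul1mx -scalemxAl KH -{1}[H]mulmx1.
  rewrite scalemxAr -mulmxBr -mulmxA; rewrite -[RHS]mulmx1; congr (_ *m _).
  rewrite mulmxBl mul1mx mulmxBr mulmx1 -scalemxAl -scalemxAr KK.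
  have -> : e *: (e *: (d *: K)) = e *: K + e *: K.
    by rewrite !scalerA -mulrA ed mulr_natr mulr2n scalerDl.
  by rewrite opprB addrK subrK.
have ux : u ^t* *m H *m x = (d / 2)%:M.
  have : D = u ^t* *m H *m x *+ 2.
    by rewrite /D mulmxDr mulr2n; congr (_ + _); rewrite /u !trCD !mulmxDl xx xy addrC.
  rewrite DE => dE; apply: (@scalerI _ _ 2); first by rewrite pnatr_eq0.
  by rewrite scaler_nat -dE scale_scalar_mx mulrC mulfVK ?pnatr_eq0.
rewrite mulmxBl mul1mx -scalemxAl /K -!mulmxA (mulmxA (u^t*)) ux mul_mx_scalar scalerA.
by rewrite mulrA ed mulfV ?pnatr_eq0 // scale1r /u opprD addrA subrr add0r.
Qed.

Lemma Jmx_block n : Jmx C n = block_mx (- 1)%:M 0 0 1%:M :> 'M_(1 + n).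
Proof.
apply/matrixP=> i k; case: (split_ordP i) => i' ->; case: (split_ordP k) => k' ->;
  rewrite ?block_mxEul ?block_mxEur ?block_mxEdl ?block_mxEdr !mxE ?eq_shift //=.
- by rewrite !ord1 (_ : lshift n 0 = ord0) ?eqxx //; apply: val_inj.
- by rewrite ord1 [X in _ *+ X](_ : _ = 0%N) //; case: eqP => // /(congr1 val).
by rewrite ord1 [X in X%:R](_ : _ = 0%N) //; case: eqP => // /(congr1 val).
Qed.

Lemma Jmx_col_mx n p q (u : 'M[C]_(1, p)) (v : 'M_(1, q)) (x : 'M_(n, p)) (y : 'M_(n, q)) :
  (col_mx u x : 'M_(1 + n, p)) ^t* *m (Jmx C n : 'M_(1 + n)) *m (col_mx v y : 'M_(1 + n, q))
    = x ^t* *m y - u ^t* *m v.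
Proof.
rewrite Jmx_block tr_col_mx map_row_mx mul_row_block !mulmx0 addr0 add0r mulmx1.
by rewrite mul_mx_scalar mul_row_col scaleN1r mulNmx addrC.
Qed.

Lemma col_mx_head n (f : 'cV[C]_n.+1) :
  exists b : 'cV[C]_n, f = col_mx (f 0 0)%:M b :> 'M_(1 + n, 1).
Proof.
exists (dsubmx (f : 'M_(1 + n, 1))).
apply: etrans (esym (vsubmxK (f : 'M_(1 + n, 1)))) _; congr col_mx.
rewrite [LHS]mx11_scalar !mxE; congr (f _ _)%:M; exact: val_inj.
Qed.

Lemma phase (a : C) : exists2 p : C, `|p| = 1 & p * a = `|a|.
Proof.
have [->|a0] := eqVneq a 0; first by exists 1; rewrite ?normr1 // mulr0 normr0.
have na : `|a| != 0 by rewrite normr_eq0.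
exists (`|a| / a); last by rewrite mulfVK.
by rewrite normf_div normr_id mulfV.
Qed.

Section Frames.
Variable n : nat.
Local Notation J := (Jmx C n).

Lemma frame_image q m (H : 'M[C]_q) (f : 'M_(n.+1, q)) (w : 'M_(n.+1, m)) R :
  isometric J R -> frame H f w -> frame H (R *m f) (R *m w).
Proof.
move=> hR [ff ww fw].
have RE p r (a : 'M[C]_(n.+1, p)) (b : 'M_(n.+1, r)) :
    (R *m a) ^t* *m J *m (R *m b) = a ^t* *m J *m b.
  exact: isometric_form.
by split; rewrite RE.
Qed.

(** The reflection exchanging the first basis vector with the opposite of a
    multiple of v moves the standard frame; the phase of the multiple is chosen
    so that the two vectors have a real product of the right sign. *)
Lemma negative_frame (v : 'cV[C]_n.+1) : negative_vec v ->
  exists d w, frame (-1)%:M (d *: v) (w : 'M_(n.+1, n)).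
Proof.
rewrite /negative_vec; set t := herm v v => t0.
pose s := sqrtC (- t); have s0 : 0 < s by rewrite sqrtC_gt0 oppr_gt0.
pose e0 : 'cV[C]_n.+1 := col_mx 1%:M 0 : 'M_(1 + n, 1).
(* p makes the first coordinate of p v / s real and nonnegative *)
have [p p1 pa] := phase (s^-1 * v 0 0).
have eJ (u : 'cV[C]_n.+1) : e0 ^t* *m J *m u = (- u 0 0)%:M.
  have [b {1}->] := col_mx_head u; apply: etrans (Jmx_col_mx _ _ _ _) _.
  by rewrite trC0 trC1 mul0mx mul1mx sub0r raddfN.
pose v2 := (p / s) *: v.
have sE : s ^+ 2 = - t by rewrite sqrtCK.
have vv : v2 ^t* *m J *m v2 = (-1)%:M.
  rewrite trCZ -!scalemxAl -scalemxAr scalerA mulrC -normCK normf_div p1.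
  rewrite (ger0_norm (ltW s0)) expr_div_n expr1n sE [_ *m v]mx11_scalar.
  by rewrite -/(herm v v) -/t -scalemx1 scalerA scalemx1 div1r invrN mulNr mulVf // lt_eqF.
have ev : e0 ^t* *m J *m v2 = (- `|s^-1 * v 0 0|)%:M.
  by rewrite eJ mxE -pa mulrA.
have ve : v2 ^t* *m J *m e0 = (- `|s^-1 * v 0 0|)%:M.
  rewrite -trC_form ev tr_scalar_mx map_scalar_mx rmorphN /=.
  by congr (- _)%:M; apply/CrealP; rewrite normr_real.
have ee : e0 ^t* *m J *m e0 = (-1)%:M.
  by apply: etrans (Jmx_col_mx _ _ _ _) _; rewrite trC0 trC1 mul0mx mul1mx sub0r raddfN.
have [||||R hR Re] := @householder _ J e0 v2.
- exact: trC_Jmx.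
- by rewrite ee vv.
- by rewrite ev ve.
- rewrite trCD !mulmxDl !mulmxDr ee ev ve vv -!raddfD /=.
  apply/eqP=> /matrixP /(_ 0 0) /eqP; rewrite !mxE /= mulr1n oppr_eq0 gt_eqF //.
  by rewrite ltr_wpDr ?addr_ge0 ?ltr_wpDr ?normr_ge0 ?ler01 ?ltr01.
exists (- (p / s)), (R *m (col_mx 0 1%:M : 'M_(1 + n, n))).
rewrite scaleNr -/v2 -Re; apply: frame_image => //; split.
- exact: ee.
- by apply: etrans (Jmx_col_mx _ _ _ _) _; rewrite trC1 trC0 mulmx1 mulmx0 subr0.
by apply: etrans (Jmx_col_mx _ _ _ _) _; rewrite trC0 trC1 mul0mx mul1mx subr0.
Qed.

End Frames.

(** A reflection moves a unit multiple of the first basis vector to b, and the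
    remaining basis vectors are an orthonormal basis of its complement. *)
Lemma unitary_sending_e1 m (b : 'cV[C]_m.+1) : b ^t* *m b = 1%:M ->
  exists (R : 'M[C]_m.+1) (x : 'cV[C]_(1 + m)) (y : 'M[C]_(1 + m, m)),
  [/\ isometric 1%:M R, R *m x = b, x ^t* *m x = 1%:M, y ^t* *m y = 1%:M
    & x ^t* *m y = 0].
Proof.
move=> bb; have [p p1 pa] := phase (b 0 0).
pose e : 'cV[C]_(1 + m) := col_mx 1%:M 0.
have eE (u : 'cV[C]_m.+1) : e ^t* *m u = (u 0 0)%:M.
  have [c {1}->] := col_mx_head u.
  by rewrite tr_col_mx map_row_mx mul_row_col trC0 mul0mx addr0 trC1 mul1mx.
have ee : e ^t* *m e = 1%:M.
  by rewrite tr_col_mx map_row_mx mul_row_col trC0 mul0mx addr0 trC1 mul1mx.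
have eb : e ^t* *m (p *: b) = `|b 0 0|%:M by rewrite eE mxE pa.
have be : (p *: b) ^t* *m e = `|b 0 0|%:M.
  have -> : (p *: b) ^t* *m e = (e ^t* *m (p *: b)) ^t* by rewrite trCM trmxCK.
  rewrite eb tr_scalar_mx map_scalar_mx; congr _%:M.
  by apply/CrealP; rewrite normr_real.
have pbb : (p *: b) ^t* *m (p *: b) = 1%:M.
  by rewrite trCZ -scalemxAl -scalemxAr scalerA mulrC -normCK p1 expr1n scale1r.
have [||||R hR Re] := @householder _ 1%:M e (p *: b); rewrite ?mulmx1.
- exact: trC1.
- by rewrite pbb.
- by rewrite eb be.
- rewrite trCD !mulmxDl !mulmxDr ee eb be pbb -!raddfD /=.
  apply/eqP=> /matrixP /(_ 0 0) /eqP; rewrite !mxE /= mulr1n gt_eqF //.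
  by rewrite ltr_wpDr ?addr_ge0 ?ltr_wpDr ?normr_ge0 ?ler01 ?ltr01.
have p0 : p != 0 by rewrite -normr_gt0 p1.
exists R, (- p^-1 *: e), (col_mx 0 1%:M); split => //.
- by rewrite -scalemxAr Re scalerN scaleNr opprK scalerA mulVf ?scale1r.
- rewrite trCZ -scalemxAl -scalemxAr scalerA ee mulrC -normCK normrN normfV p1.
  by rewrite invr1 expr1n scale1r.
- by rewrite tr_col_mx map_row_mx mul_row_col trC0 mul0mx add0r trC1 mulmx1.
rewrite trCZ -scalemxAl tr_col_mx map_row_mx mul_row_col mulmx0 trC0 mul0mx.
by rewrite addr0 scaler0.
Qed.

(** After scaling, f = (1, b) with b a unit vector.  A rotation of the definite
    coordinates reduces to the case where b is a multiple of the first basis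
    vector, and there (-1, b) / 2 and the other basis vectors complete f. *)
Lemma null_frame_exists m (f : 'cV[C]_m.+2) : f != 0 -> null_vec f ->
  exists d g (w : 'M_(m.+2, m)), [/\ d != 0 & null_frame (d *: f) g w].
Proof.
move=> f0 ff; pose a := f 0 0.
have [b] := col_mx_head f; rewrite -/a => fE.
have JE : f ^t* *m Jmx C m.+1 *m f = b ^t* *m b - (a%:M) ^t* *m a%:M.
  by rewrite fE; apply: Jmx_col_mx.
have bb : b ^t* *m b = (`|a| ^+ 2)%:M.
  move: ff; rewrite /null_vec /herm JE => bb; apply/eqP; rewrite -subr_eq0.
  rewrite [b ^t* *m b]mx11_scalar -raddfB /=; move: bb; rewrite mxE.
  rewrite tr_scalar_mx map_scalar_mx mul_scalar_mx !mxE mulr1n mulrC -normCK.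
  by move=> ->; rewrite raddf0.
have a0 : a != 0.
  apply: contra f0 => /eqP a0; rewrite fE a0 raddf0.
  have b0 : b = 0.
    rewrite -[b]trmxCK; have [->|bn0] := eqVneq (b ^t*) 0; first exact: trC0.
    have := dotmx_is_dotmx bn0.
    by rewrite dotmxE trmxCK bb a0 normr0 expr0n raddf0 mxE ltxx.
  by rewrite b0; apply/eqP; exact: (@col_mx0 _ 1 m.+1 1).
have a10 : a^-1 != 0 by rewrite invr_eq0.
have bb1 : (a^-1 *: b) ^t* *m (a^-1 *: b) = 1%:M.
  rewrite trCZ -scalemxAl -scalemxAr scalerA mulrC -normCK bb scale_scalar_mx.
  by rewrite normfV -exprMn mulVf ?expr1n // normr_eq0.
have [R [x [y [hR Rx xx yy xy]]]] := unitary_sending_e1 bb1.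
pose T : 'M[C]_m.+2 := block_mx 1%:M 0 0 R : 'M_(1 + m.+1).
have hT : isometric (Jmx C m.+1) T.
  by rewrite Jmx_block; apply: (@isometric_block _ 1 m.+1) => //; apply: isometric1.
have TE p (r : nat) (u : 'M[C]_(m.+2, p)) (v : 'M[C]_(m.+2, r)) :
    (T *m u) ^t* *m Jmx C m.+1 *m (T *m v) = u ^t* *m Jmx C m.+1 *m v.
  exact: isometric_form.
have Tf : T *m (col_mx 1%:M x : 'M_(1 + m.+1, 1)) = a^-1 *: f.
  have -> : T *m (col_mx 1%:M x : 'M_(1 + m.+1, 1)) =
      col_mx (1%:M *m 1%:M + 0 *m x) (0 *m 1%:M + R *m x).
    exact: (@mul_block_col _ 1 m.+1 1 m.+1 1).
  rewrite !mul0mx mulmx1 addr0 add0r Rx fE.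
  have -> : a^-1 *: (col_mx a%:M b : 'M_(1 + m.+1, 1)) = col_mx (a^-1 *: a%:M) (a^-1 *: b).
    exact: (@scale_col_mx _ 1 m.+1 1).
  by rewrite scale_scalar_mx mulVf.
pose h : 'M[C]_1 := (2^-1)%:M.
exists a^-1, (T *m (col_mx (- h) (2^-1 *: x) : 'M_(1 + m.+1, 1))),
  (T *m (col_mx 0 y : 'M_(1 + m.+1, m))); split => //.
rewrite -Tf /null_frame !TE.
have ht : h ^t* = h.
  by rewrite tr_scalar_mx map_scalar_mx fmorphV /= conjC_nat.
have hh : h + h = 1%:M.
  by rewrite -raddfD /= -mulr2n -[2^-1 *+ 2]mulr_natl mulfV // pnatr_eq0.
have h2 : 2^-1 *: 1%:M = h by rewrite scalemx1.
split; split; (apply: etrans (Jmx_col_mx _ _ _ _) _);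
  rewrite ?trCZ ?trC1 ?trC0 ?trCB -?scalemxAl -?scalemxAr ?xx ?yy ?xy ?scaler0 ?h2;
  rewrite ?mulmx1 ?mul1mx ?mulmx0 ?subrr ?subr0 //.
  by rewrite opprK hh.
have -> : (- h) ^t* = - h by rewrite linearN /= map_mxN ht.
by rewrite fmorphV /= conjC_nat mulNmx mulmxN opprK mul_scalar_mx subrr.
Qed.

End FrameExistence.

(** * Eigenvectors in the closed ball *)

Section Eigen.
Variables (C : numClosedFieldType) (n : nat).
Local Notation N := n.+1.
Local Notation J := (Jmx C n).

Lemma herm_real (v : 'cV[C]_N) : herm v v \is Num.real.
Proof. by apply/CrealP; rewrite -herm_conj. Qed.

(** The form takes the value -1, so it has no positive orthonormal basis. *)
Lemma orthonormal_columns_neq j (X : 'M[C]_(N, j)) : X ^t* *m J *m X = 1%:M -> j <> N.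
Proof.
move=> XX jN; move: X XX; rewrite jN => X XX.
have : X *m X ^t* = J.
  by rewrite -[LHS]mulmx1 -JmxK mulmxA -[X in X *m _]mulmxA (mulmx1C XX) mul1mx.
move/matrixP/(_ 0 0); rewrite !mxE /= mulr1n => E.
have : 0 <= (-1 : C).
  by rewrite -E sumr_ge0 // => i _; rewrite !mxE mul_conjC_ge0.
by rewrite oppr_ge0 lt_geF ?ltr01.
Qed.

(** The span of X is invariant under the isometry A, hence so is its orthogonal
    complement, which is not zero for reasons of dimension. *)
Lemma eigenvector_orthogonal j (A : 'M[C]_N) (X : 'M[C]_(N, j)) K :
  isometric J A -> (j < N)%N -> X ^t* *m J *m X = 1%:M -> A *m X = X *m K ->
  exists (y : 'cV[C]_N) a, [/\ y != 0, A *m y = a *: y & X ^t* *m J *m y = 0].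
Proof.
move=> hA jN XX AX.
have AXX p (y : 'M[C]_(N, p)) : (A *m X) ^t* *m J *m (A *m y) = X ^t* *m J *m y.
  exact: isometric_form.
have KK : K ^t* *m K = 1%:M.
  by have := AXX _ X; rewrite AX form_mul XX mulmx1.
have stab p (y : 'M[C]_(N, p)) : X ^t* *m J *m y = 0 -> X ^t* *m J *m (A *m y) = 0.
  rewrite -AXX AX trCM -!mulmxA => /(congr1 (mulmx K)).
  by rewrite mulmxA (mulmx1C KK) mul1mx mulmx0.
have [M MT] : exists M, M^T = X ^t* *m J by exists (X ^t* *m J)^T; rewrite trmxK.
have [r [Z [r0 Zfree ZP]]] : exists r (Z : 'M_(r, N)),
    [/\ (0 < r)%N, row_free Z & forall p (u : 'M_(p, N)), (u <= Z)%MS = (u *m M == 0)].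
  exists (\rank (kermx M)), (row_base (kermx M)); split; last 1 first.
  - by move=> p u; rewrite eq_row_base; apply/sub_kermxP/eqP.
  - by rewrite mxrank_ker subn_gt0 (leq_ltn_trans (rank_leq_col _)).
  exact: row_base_free.
have ZM : Z *m M = 0 by apply/eqP; rewrite -ZP.
have /submxP[L LE] : (Z *m A^T <= Z)%MS.
  rewrite ZP; apply/eqP/trmx_inj.
  rewrite !trmx_mul trmxK trmx0 MT; apply: stab.
  by rewrite -MT -trmx_mul ZM trmx0.
have [a /eigenvalueP[v vL v0]] := eigenvalue_closed L r0.
exists (v *m Z)^T, a; split.
- apply: contra v0 => /eqP/(congr1 trmx); rewrite trmxK trmx0 => /eqP.
  by rewrite mulmx_free_eq0.
- apply: trmx_inj; rewrite trmx_mul trmxK linearZ /= trmxK -mulmxA LE mulmxA vL.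
  by rewrite scalemxAl.
by rewrite -MT -trmx_mul -mulmxA ZM mulmx0 trmx0.
Qed.

(** If all eigenvectors were positive, an orthonormal family spanning an invariant
    subspace could be extended by an eigenvector of its complement until it is
    a basis, contradicting the signature. *)
Lemma nonpositive_eigenvector (A : 'M[C]_N) : isometric J A ->
  exists (v : 'cV[C]_N) l, [/\ v != 0, A *m v = l *: v & herm v v <= 0].
Proof.
move=> hA; apply: contrapT => noneg.
suff: exists (X : 'M[C]_N) K, X ^t* *m J *m X = 1%:M /\ A *m X = X *m K.
  by case=> X [K [XX _]]; apply: (orthonormal_columns_neq XX).
(* X has j orthonormal columns that span an A-invariant subspace. *)
suff H j : (j <= N)%N -> exists (X : 'M[C]_(N, j)) K,
    X ^t* *m J *m X = 1%:M /\ A *m X = X *m K by exact: H.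
elim: j => [_|j IHj lt_jN].
  by exists 0, 0; split; [apply/matrixP=> -[] | rewrite !mulmx0].
have [X [K [XX AX]]] := IHj (ltnW lt_jN).
have [y [a [y0 Ay Xy]]] := eigenvector_orthogonal hA lt_jN XX AX.
have hy : 0 < herm y y.
  have [//||h0] := real_ltgtP (real0 _) (herm_real y); last first.
    by case: noneg; exists y, a; rewrite -h0 lexx.
  by move=> h0; case: noneg; exists y, a; rewrite ltW.
pose s := sqrtC (herm y y); have s0 : 0 < s by rewrite sqrtC_gt0.
have ss : (s^-1) ^* = s^-1 by apply/CrealP; rewrite realV gtr0_real.
have y1 : (s^-1 *: y) ^t* *m J *m (s^-1 *: y) = 1%:M.
  rewrite trCZ ss -!scalemxAl -scalemxAr scalerA [_ *m y]mx11_scalar -/(herm y y).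
  by rewrite scale_scalar_mx -expr2 exprVn sqrtCK mulVf ?gt_eqF.
have Xy' : X ^t* *m J *m (s^-1 *: y) = 0 by rewrite -scalemxAr Xy scaler0.
have XX' : (row_mx (s^-1 *: y) X) ^t* *m J *m row_mx (s^-1 *: y) X = 1%:M :> 'M_(1 + j).
  rewrite trC_row mul_col_mx mul_col_row y1 XX Xy' -(trC_form X) Xy' trC0.
  by rewrite -scalar_mx_block.
have AX' : A *m row_mx (s^-1 *: y) X = row_mx (s^-1 *: y) X *m block_mx a%:M 0 0 K.
  rewrite mul_mx_row mul_row_block !mulmx0 addr0 add0r -scalemxAr Ay AX.
  by rewrite mul_mx_scalar !scalerA mulrC.
by exists (row_mx (s^-1 *: y) X : 'M_(N, 1 + j)), (block_mx a%:M 0 0 K : 'M_(1 + j)).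
Qed.

End Eigen.

(** * Jordan blocks of size three *)

Section Jordan.
Variables (C : numClosedFieldType) (n : nat).
Local Notation N := n.+1.
Local Notation V := 'cV[C]_N.

Lemma horner_mx_linear_power m (M : 'M[C]_m.+1) l k :
  horner_mx M (('X - l%:P) ^+ k) = (M - l%:M) ^+ k.
Proof. by rewrite rmorphXn rmorphB /= horner_mx_X horner_mx_C. Qed.

(** F is the matrix whose columns are the vectors of b, so identities for
    [matrix_in b A] transfer to A on U. *)
Lemma basis_intertwiner (A : Ugrp C n) (U : {vspace V}) m (b : m.-tuple V) :
  preserves A U -> basis_of U b ->
  exists F : 'M[C]_(N, m), [/\ Uval A *m F = F *m matrix_in b A,
    forall u, u \in U -> exists x : 'cV_m, u = F *m x
    & forall x : 'cV_m, F *m x = 0 -> x = 0].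
Proof.
move=> AU bU; pose F : 'M[C]_(N, m) := \matrix_(i, j) (b`_j) i 0.
have FE (x : 'cV[C]_m) : F *m x = \sum_j x j 0 *: b`_j.
  apply/colP=> i; rewrite mxE summxE; apply: eq_bigr => j _.
  by rewrite !mxE mulrC.
have colF j : F *m delta_mx j 0 = b`_j.
  by rewrite -colE; apply/colP=> i; rewrite !mxE.
exists F; split.
- apply/matrixP=> i j; have /(congr1 (fun u : V => u i 0)) :
      Uval A *m b`_j = F *m (matrix_in b A *m delta_mx j 0).
    have bjU : b`_j \in U by rewrite (basis_mem bU) // mem_nth // size_tuple.
    have AbU : lact A b`_j \in U by apply: (subvP AU); apply: memv_img.
    rewrite FE -lactE {1}(coord_basis bU AbU); apply: eq_bigr => k _.
    by rewrite -colE !mxE.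
  by rewrite -colF !mulmxA -!colE !mxE.
- move=> u uU; exists (\col_j coord b j u); rewrite FE {1}(coord_basis bU uU).
  by apply: eq_bigr => j _; rewrite mxE.
move=> x; rewrite FE => x0; have {}x0 := elimT freeP (basis_free bU) (fun j => x j 0) x0.
by apply/colP=> j; rewrite x0 mxE.
Qed.

Lemma intertwined_power (A : 'M[C]_N) m (F : 'M[C]_(N, m.+1)) M l k :
  A *m F = F *m M -> (A - l%:M) ^+ k *m F = F *m (M - l%:M) ^+ k.
Proof.
move=> AF; elim: k => [|k IHk]; first by rewrite !expr0 mul1mx mulmx1.
rewrite !exprSr -!mulmxE -mulmxA mulmxBl AF mul_scalar_mx -mul_mx_scalar.
by rewrite -mulmxBr !mulmxA IHk.
Qed.

(** Unlike the data of [jordan_part], this involves only one matrix, and it is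
    invariant under scaling. *)
Definition has_height_3 (B : 'M[C]_N) :=
  exists (a : C) (v : V), (B - a%:M) ^+ 3 *m v = 0 /\ (B - a%:M) ^+ 2 *m v != 0.

Lemma has_height_3Z (B : 'M[C]_N) c : c != 0 -> has_height_3 B -> has_height_3 (c *: B).
Proof.
move=> c0 [a [v [v3 v2]]]; exists (c * a), v.
rewrite -scale_scalar_mx -scalerBr !exprZn -!scalemxAl v3 scaler0; split => //.
by rewrite scaler_eq0 expf_eq0 (negPf c0).
Qed.

(** By minimality of the minimal polynomial (x - l)^3, the square of M - l is not
    zero, where M is the matrix of A on U. *)
Lemma jordan_part2_height T : jordan_part 2 T ->
  exists2 A : Ugrp C n, piPU A = T & has_height_3 A.
Proof.
move=> [A [l [U [W [[AT _ _] [[_ AU _ _] [_ [b [bU _ minp]]]]]]]]].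
exists A => //; have [F [AF _ F0]] := basis_intertwiner AU bU.
set M := matrix_in b A in AF minp.
have M3 : (M - l%:M) ^+ 3 = 0 by rewrite -horner_mx_linear_power -minp mx_root_minpoly.
have M2 : (M - l%:M) ^+ 2 != 0.
  rewrite -horner_mx_linear_power; apply/eqP=> /mxminpoly_min.
  have q0 : ('X - l%:P) ^+ 2 != 0 by rewrite expf_neq0 // polyXsubC_eq0.
  by rewrite minp => /(dvdp_leq q0); rewrite !size_exp_XsubC.
have [j xj] : exists j, (M - l%:M) ^+ 2 *m delta_mx j (0 : 'I_1) != 0.
  apply: contrapT => nex; case/eqP: M2; apply/matrixP=> i j.
  have : (M - l%:M) ^+ 2 *m delta_mx j (0 : 'I_1) = 0.
    by apply: contrapT => /eqP xj; apply: nex; exists j.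
  by rewrite -colE => /colP /(_ i); rewrite !mxE.
exists l, (F *m delta_mx j 0); rewrite !mulmxA !(intertwined_power _ _ AF) M3 mulmx0 mul0mx.
split => //; rewrite -mulmxA; apply: contra xj => /eqP /F0 ->; exact: eqxx.
Qed.

Lemma preserves_sub_scalar_power (A : Ugrp C n) (S : {vspace V}) a k u :
  preserves A S -> u \in S -> (Uval A - a%:M) ^+ k *m u \in S.
Proof.
move=> AS uS; elim: k => [|k IHk]; first by rewrite expr0 mul1mx.
rewrite exprS -mulmxE -mulmxA mulmxBl mul_scalar_mx rpredB ?rpredZ // -(lactE A).
by apply: (subvP AS); apply: memv_img.
Qed.

(** Split w along the eigenspace K of a in W and an invariant complement U'.
    For the component y of w in U', the vector (A - a)^2 y lies in both K and U'
    when (A - a)^3 w = 0. *)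
Lemma semisimple_height (A : Ugrp C n) (W : {vspace V}) a w :
  preserves A W -> semisimple_on A W -> w \in W ->
  (Uval A - a%:M) ^+ 3 *m w = 0 -> (Uval A - a%:M) ^+ 2 *m w = 0.
Proof.
move=> AW ssW wW w3; pose G := Uval A - a%:M.
pose K := (W :&: lker (lact G))%VS.
have KP x : (x \in K) = (x \in W) && (G *m x == 0).
  by rewrite memv_cap memv_ker lactE.
have [||U' [U'W AU' KU' /directv_addP KU0]] := ssW K; first exact: capvSl.
  apply/subvP=> _ /memv_imgP[x + ->]; rewrite KP lactE => /andP[xW /eqP Gx].
  have Ax : Uval A *m x = a *: x.
    by apply/eqP; rewrite -subr_eq0 -mul_scalar_mx -mulmxBl; apply/eqP.
  by rewrite Ax KP rpredZ // -scalemxAr Gx scaler0 eqxx.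
move: wW w3; rewrite -KU' => /memv_addP[x + [y yU' ->]].
rewrite KP => /andP[_ /eqP Gx]; rewrite !mulmxDr -/G !exprSr !expr0 !mul1r -!mulmxE.
rewrite -!(mulmxA _ G x) Gx !mulmx0 !add0r => y3.
have : G *m G *m y \in (K :&: U')%VS.
  have GGy : G *m G *m y \in U'.
    by have := preserves_sub_scalar_power a 2 AU' yU'; rewrite expr2.
  by rewrite memv_cap GGy andbT KP (subvP U'W) //= !mulmxA y3.
by rewrite KU0 memv0 => /eqP.
Qed.

(** A generalized eigenvector v for a splits along U and W.  On W, semisimplicity
    applies.  On U, (A - l)^2 vanishes: if l = a this is the claim, and otherwise
    (A - a)^2 (A - l)^2 u is (a - l)^2 (A - a)^2 u when (A - a)^3 u = 0. *)
Lemma jordan_part1_height T (A : Ugrp C n) :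
  jordan_part 1 T -> piPU A = T -> ~ has_height_3 A.
Proof.
move=> [B [l [U [W [[BT _ _] [[[UW /directv_addP UW0 _] BU BW ssW]]]]]]].
move=> [_ [b [bU _ minp]]] AT hA.
have {hA} : has_height_3 B.
  have /piPUP[c c1 ->] : piPU A = piPU B by rewrite AT BT.
  by apply: has_height_3Z hA; rewrite -normr_gt0 c1.
move=> [a [v [v3]]]; apply/negP; rewrite negbK.
have [F [BF FU _]] := basis_intertwiner BU bU.
have : v \in (U + W)%VS by rewrite UW memvf.
case/memv_addP=> u uU [w wW vE].
have u3 : (Uval B - a%:M) ^+ 3 *m u = - ((Uval B - a%:M) ^+ 3 *m w).
  by apply/eqP; rewrite -addr_eq0 -mulmxDr -vE v3.
have u30 : (Uval B - a%:M) ^+ 3 *m u = 0.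
  apply/eqP; rewrite -memv0 -UW0 memv_cap preserves_sub_scalar_power //=.
  by rewrite u3 rpredN preserves_sub_scalar_power.
have w30 : (Uval B - a%:M) ^+ 3 *m w = 0.
  by apply/eqP; rewrite -oppr_eq0 -u3 u30.
rewrite vE mulmxDr (semisimple_height BW ssW wW w30) addr0.
have l2 : (Uval B - l%:M) ^+ 2 *m u = 0.
  have [x ->] := FU _ uU.
  rewrite mulmxA (intertwined_power _ _ BF) -horner_mx_linear_power -minp.
  by rewrite mx_root_minpoly mulmx0 mul0mx.
have [<-|la] := eqVneq l a; first by rewrite l2.
set G := Uval B - a%:M in u30 *.
have Gcomm (x : V) : G ^+ 3 *m x = 0 ->
    G ^+ 3 *m ((Uval B - l%:M) *m x) = 0 /\
    G ^+ 2 *m ((Uval B - l%:M) *m x) = (a - l) *: (G ^+ 2 *m x).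
  have -> : Uval B - l%:M = G + (a - l)%:M by rewrite raddfB /= addrA subrK.
  move: (G) => D x3; rewrite !mulmxDl mul_scalar_mx !mulmxDr -!scalemxAr x3 scaler0 addr0.
  have G3 : D ^+ 2 *m D = D ^+ 3 by rewrite [RHS]exprSr.
  have G4 : D ^+ 3 *m D = D *m D ^+ 3 by rewrite !mulmxE -exprSr -exprS.
  by rewrite !mulmxA G3 G4 x3 -(mulmxA D) x3 mulmx0 add0r.
have [u31 u21] := Gcomm u u30; have [_ u22] := Gcomm _ u31.
have l2' : (Uval B - l%:M) *m ((Uval B - l%:M) *m u) = 0 by rewrite mulmxA.
move: u22; rewrite u21 l2' mulmx0 => /esym/eqP.
by rewrite !scaler_eq0 subr_eq0 eq_sym (negPf la).
Qed.

End Jordan.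

(** * Fixed points and the theorem *)

Section Main.
Variables (C : numClosedFieldType) (n : nat).
Local Notation V := 'cV[C]_n.+1.
Implicit Types (A : Ugrp C n) (T : PU C n).

Lemma fixes_lineP A (v : V) : v != 0 ->
  (fixes (piPU A) <[v]>%VS <-> exists2 l, l != 0 & Uval A *m v = l *: v).
Proof.
move=> v0; rewrite /fixes pu_actE limg_line lactE; split=> [E|[l l0 ->]].
  have /vlineP[l Av] : Uval A *m v \in <[v]>%VS by rewrite -E memv_line.
  exists l => //; apply: contra v0 => /eqP l0; rewrite -memv0.
  have : v \in <[v]>%VS by rewrite memv_line.
  by rewrite -{1}E Av l0 scale0r => /vlineP[c ->]; rewrite scaler0 mem0v.
apply/vspaceP=> x; apply/vlineP/vlineP=> -[c ->].
  by exists (c * l); rewrite scalerA.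
by exists (c / l); rewrite scalerA mulfVK.
Qed.

Lemma eigenvalue_neq0 A (v : V) l : v != 0 -> Uval A *m v = l *: v -> l != 0.
Proof.
move=> v0 Av; apply: contra v0 => /eqP l0.
by rewrite -[v](mulKmx (Uunit A)) Av l0 scale0r mulmx0.
Qed.

Lemma elliptic_inv4_reflection T j : elliptic T -> (j < n)%N \/ j = 0 ->
  inv4_reflection j T.
Proof.
rewrite -[T]reprK -/(piPU _); move: (repr T) => A [_ [v v0 ->] fixv] jn.
have vn0 : v != 0.
  by apply: contraTneq v0 => ->; rewrite /negative_vec /herm mulmx0 mxE ltxx.
have [l _ Av] := (fixes_lineP A vn0).1 fixv.
have [d [w fr]] := negative_frame v0.
apply: (elliptic_frame_factorization (l := l) fr) => //.
by rewrite -scalemxAr Av !scalerA mulrC.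
Qed.

(** A negative eigenvector would span a fixed point of the ball. *)
Lemma null_eigenvector_of_not_elliptic A : ~ elliptic (piPU A) ->
  exists (v : V) l, [/\ v != 0, Uval A *m v = l *: v & null_vec v].
Proof.
move=> nell; have [v [l [v0 Av]]] := nonpositive_eigenvector (UE A).
rewrite le_eqVlt => /orP[/eqP vv|vneg]; first by exists v, l.
case: nell; exists <[v]>%VS; first by exists v.
by apply/(fixes_lineP A v0); exists l => //; apply: eigenvalue_neq0 Av.
Qed.

End Main.

Lemma null_vec_dim0 (C : numClosedFieldType) (v : 'cV[C]_1) : null_vec v -> v = 0.
Proof.
have [b vE] := col_mx_head v.
have JE : v ^t* *m Jmx C 0 *m v = b ^t* *m b - (v 0 0)%:M ^t* *m (v 0 0)%:M.
  by rewrite {1 2}vE; apply: Jmx_col_mx.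
rewrite /null_vec /herm JE [b]flatmx0 mulmx0 sub0r tr_scalar_mx map_scalar_mx.
rewrite -scalar_mxM !mxE mulr1n mulrC -normCK => /eqP.
rewrite oppr_eq0 expf_eq0 normr_eq0 /= => /eqP v0.
by rewrite [v]mx11_scalar v0 raddf0.
Qed.

Lemma boundary_inv4_reflection (C : numClosedFieldType) n (T : PU C n) j :
  ~ elliptic T -> (j.+1 < n)%N \/ j = 0 -> inv4_reflection j.+1 T.
Proof.
rewrite -[T]reprK -/(piPU _); move: (repr T) => A nell jn.
have [f [l [f0 Af ff]]] := null_eigenvector_of_not_elliptic nell.
case: n => [|m] in T A nell jn f Af f0 ff *.
  by case/eqP: f0; apply: null_vec_dim0 ff.
have [d [g [w [d0 fr]]]] := null_frame_exists f0 ff.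
apply: (boundary_frame_factorization (l := l) (erefl : m.+2 = (1 + 1 + m)%N) fr).
- by rewrite -scalemxAr Af !scalerA mulrC.
- exact: eigenvalue_neq0 Af.
by case: jn => [|->]; [left | right].
Qed.

Lemma bd_point_not_hyp_point (C : numClosedFieldType) n (L : {vspace 'cV[C]_n.+1}) :
  bd_point L -> ~ hyp_point L.
Proof.
move=> [v [_ vv] ->] [u uneg E].
have /vlineP[c uE] : u \in <[v]>%VS by rewrite E memv_line.
move: uneg; rewrite /negative_vec uE /herm -scalemxAr mxE.
rewrite trCZ -!scalemxAl mxE; move: vv; rewrite /null_vec /herm => ->.
by rewrite !mulr0 ltxx.
Qed.

Lemma parabolic_not_elliptic (C : numClosedFieldType) n (T : PU C n) :
  parabolic T -> ~ elliptic T.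
Proof.
move=> [L [bL _ uniq]] [M hM fM]; have ML := uniq M (or_introl hM) fM.
by rewrite ML in hM; apply: bd_point_not_hyp_point bL hM.
Qed.

Lemma hyperbolic_not_elliptic (C : numClosedFieldType) n (T : PU C n) :
  hyperbolic T -> ~ elliptic T.
Proof.
move=> [L1 [L2 [_ b1 b2 fix12]]] [M hM fM].
case: ((fix12 M (or_introl hM)).1 fM) => ML; rewrite ML in hM.
  exact: bd_point_not_hyp_point b1 hM.
exact: bd_point_not_hyp_point b2 hM.
Qed.

Lemma hyperbolic_not_parabolic (C : numClosedFieldType) n (T : PU C n) :
  hyperbolic T -> ~ parabolic T.
Proof.
move=> [L1 [L2 [L12 b1 b2 fix12]]] [L [_ _ uniq]].
have f1 : fixes T L1 by apply/(fix12 L1 (or_intror b1)); left.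
have f2 : fixes T L2 by apply/(fix12 L2 (or_intror b2)); right.
by apply: L12; rewrite (uniq L1 (or_intror b1) f1) (uniq L2 (or_intror b2) f2).
Qed.

Theorem theorem4p1 (R : realType) (n : nat) (T : PU R[i] n) :
  exists k : nat,
    (k <= 2)%N /\
    (elliptic T -> k = 0%N) /\
    (ellipto_translation T \/ hyperbolic T -> k = 1%N) /\
    (ellipto_parabolic T /\ (2 < n)%N -> k = 2%N) /\
    inv4_reflection k T.
Proof.
have [ell|nell] := pselect (elliptic T).
  exists 0; do !split => //.
  - case=> [[[/parabolic_not_elliptic] //]|/hyperbolic_not_elliptic //].
  - by move=> [[[/parabolic_not_elliptic]]].
  exact: elliptic_inv4_reflection ell (or_intror erefl).
have [[ep n2]|nep] := pselect (ellipto_parabolic T /\ (2 < n)%N).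
  have [[par _] j2] := ep.
  exists 2; do !split => //.
  - move=> [[_ j1]|/hyperbolic_not_parabolic] //.
    have [A AT h3] := jordan_part2_height j2.
    by case: (jordan_part1_height j1 AT).
  exact: boundary_inv4_reflection nell (or_introl n2).
exists 1; do !split => //.
exact: boundary_inv4_reflection nell (or_intror erefl).
Qed.
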